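(* For every integer $n>1$: if $p\in[2,\infty)$ then $$H_p^n=\Big(\frac{2^p-1}{2^{p+1}-1}\Big)^{1/p};$$ and if $p\in(0,2)$ there exist constants $C,D>0$ (depending only on $p$) such that for all $n>1$, $$C\Big(\frac{\log n}{n}\Big)^{\frac{2-p}{2p}}\le H_p^n\le D\Big(\frac{\log n}{n}\Big)^{\frac{2-p}{2p}}.$$
   Context: For $p>0$ and a holomorphic $f:\mathbb D^n\to\mathbb C$ ($\mathbb D^n$ the open unit polydisk), $f(z)=x_0+\sum_{|\alpha|\ge1}x_\alpha z^\alpha$ (multi-index notation) with $\operatorname{Re}f(z)>0$ on $\mathbb D^n$ and $f(0)=1$, let $H_p^n(f)=\sup\{r\ge0:\frac12(|x_0|^p+\sum_{k\ge1}\sum_{|\alpha|=k}|x_\alpha z^\alpha|^p)^{1/p}\le1\ \forall z\in r\mathbb D^n\}$, and $H_p^n=\inf$ of $H_p^n(f)$ over all such $f$. *)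

(* Defs.v *)
From HB Require Import structures.
From mathcomp Require Import all_boot all_order all_algebra.
From mathcomp Require Import all_classical all_reals all_analysis.
From mathcomp Require Import complex.
Set Implicit Arguments. Unset Strict Implicit. Unset Printing Implicit Defensive.
Import Order.TTheory GRing.Theory Num.Theory numFieldNormedType.Exports.
Local Open Scope ring_scope.

Definition cmod (R : realType) (w : R[i]) : R := Normc.normc w.

Definition mono (R : realType) (n : nat) (z : 'I_n -> R[i]) (a : 'I_n -> nat)
  : R[i] := \prod_(i < n) z i ^+ a i.

(* Finite sum over all multi-indices alpha with |alpha| = k:
   such alpha are enumerated as ffuns 'I_n -> 'I_k.+1 with total sum k. *)
Definition hsum (R : realType) (n k : nat) (F : ('I_n -> nat) -> R) : R :=
  \sum_(a : {ffun 'I_n -> 'I_k.+1} | (\sum_(i < n) val (a i))%N == k)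
     F (fun i => val (a i)).

Definition polydisk (R : realType) (n : nat) (r : R) : set ('I_n -> R[i]) :=
  [set z | forall i, cmod (z i) < r].

(* Coefficient families x : N^n -> C of holomorphic f : D^n -> C with
   Re f > 0 and f(0) = 1, where f(z) = sum_alpha x_alpha z^alpha.  A function
   on the polydisk is holomorphic iff it is the sum of a power series that
   converges absolutely on D^n; Re f(z) is the limit of the (absolutely
   convergent) series of real parts, grouped by homogeneous degree. *)
Definition caratheodory (R : realType) (n : nat) : set (('I_n -> nat) -> R[i]) :=
  [set x | x (fun _ => 0%N) = 1 /\
    forall z, @polydisk R n 1 z ->
      (\sum_(0 <= k <oo) (@hsum R n k (fun a => cmod (x a * @mono R n z a)))%:E
          < +oo)%E /\
      0 < limn (series (fun k => @hsum R n k (fun a => complex.Re (x a * @mono R n z a))))].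

Definition bohr_sum (R : realType) (n : nat) (p : R)
    (x : ('I_n -> nat) -> R[i]) (z : 'I_n -> R[i]) : \bar R :=
  ((cmod (x (fun _ => 0%N)) `^ p)%:E +
   \sum_(1 <= k <oo) (@hsum R n k (fun a => cmod (x a * @mono R n z a) `^ p))%:E)%E.

Definition Hpf (R : realType) (n : nat) (p : R) (x : ('I_n -> nat) -> R[i])
  : \bar R :=
  ereal_sup [set r%:E | r in [set r : R | 0 <= r /\
     forall z, @polydisk R n r z ->
       ((2^-1)%:E * (@bohr_sum R n p x z `^ (p^-1)) <= 1)%E]].

Definition Hpn (R : realType) (n : nat) (p : R) : \bar R :=
  ereal_inf [set @Hpf R n p x | x in @caratheodory R n].

(* Main.v *)
Require Import Defs.
From HB Require Import structures.
From mathcomp Require Import all_boot all_order all_algebra.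
From mathcomp Require Import all_classical all_reals all_analysis.
From mathcomp Require Import complex.
From mathcomp Require Import cyclic separable cyclotomic ring lra.
Set Implicit Arguments. Unset Strict Implicit. Unset Printing Implicit Defensive.
Import Order.TTheory GRing.Theory Num.Theory numFieldNormedType.Exports.
Local Open Scope ring_scope.

(* Let P_k be the k-homogeneous part of f. Applied to t |-> f(t z), the
   one-variable Caratheodory inequality gives |P_k| <= 2 on the polydisk. All
   integrals over the torus are replaced by averages over N-th roots of unity.

   For p >= 2, Parseval gives sum_{|a| = k} |x_a|^2 <= 4, hence
   sum_{|a| = k} |x_a|^p <= 2^p, which is sharp for (1 + z_1) / (1 - z_1).

   For p < 2, write s = 1 - p/2 and bound sum_{|a| = k} |x_a|^p by
   sum_j sum_{a_j > 0} |a_j x_a|^p, the coefficients of the derivatives d_j P_k.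
   Hoelder's inequality bounds the inner sum by (e^k (1 + n/k)^(k-1))^s |d_j P_k|_2^p;
   the L^2 norm is at most C^k times the L^1 norm by hypercontractivity (a
   count of the products in P^2 controls the L^4 norm); and
   sum_j |d_j P_k(z)| <= C^k, as it is the first coefficient of t |-> P_k(z + t w)
   for suitable unimodular w_j. Having k - 1 rather than k in the exponent gains a
   positive power of n, enough to replace (n/k)^(k s) by C^k (n / ln n)^(k s).

   Conversely f = 1 + P, with P a multiple of
   sum_{i_1, ..., i_m < N} w^(i_1 i_2 + i_2 i_3 + ...) z_(1,i_1) ... z_(m,i_m),
   w a primitive N-th root of unity, m close to log_2 n and N = n / m. This sum is
   an iterated product of Fourier matrices and diagonal contractions, so it is at
   most N^((m+1)/2) while it has N^m unimodular coefficients. *)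

(** * Complex moduli and roots of unity *)

Lemma cmodE (R : realType) (w : R[i]) :
  cmod w = Num.sqrt (complex.Re w ^+ 2 + complex.Im w ^+ 2).
Proof. by case: w. Qed.

Lemma cmod_ge0 (R : realType) (w : R[i]) : 0 <= cmod w.
Proof. by rewrite cmodE sqrtr_ge0. Qed.

Lemma cmod_sqr (R : realType) (w : R[i]) :
  cmod w ^+ 2 = complex.Re w ^+ 2 + complex.Im w ^+ 2.
Proof. by rewrite cmodE sqr_sqrtr // addr_ge0 // sqr_ge0. Qed.

Lemma cmodM (R : realType) (v w : R[i]) : cmod (v * w) = cmod v * cmod w.
Proof. exact: Normc.normcM. Qed.

Lemma cmod0 (R : realType) : cmod (0 : R[i]) = 0.
Proof. exact: Normc.normc0. Qed.

Lemma cmod1 (R : realType) : cmod (1 : R[i]) = 1.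
Proof. exact: Normc.normc1. Qed.

Lemma cmodV (R : realType) (w : R[i]) : cmod w^-1 = (cmod w)^-1.
Proof. exact: Normc.normcV. Qed.

Lemma cmod_eq0 (R : realType) (w : R[i]) : (cmod w == 0) = (w == 0).
Proof.
by apply/eqP/eqP => [|->]; [exact: Normc.eq0_normc | exact: cmod0].
Qed.

Lemma cmodX (R : realType) (w : R[i]) k : cmod (w ^+ k) = cmod w ^+ k.
Proof.
by elim: k => [|k IH]; rewrite ?expr0 ?cmod1// !exprS cmodM IH.
Qed.

Lemma cmod_real (R : realType) (r : R) : cmod r%:C%C = `|r|.
Proof. by rewrite cmodE /= expr0n addr0 sqrtr_sqr. Qed.

Lemma cmod_nat (R : realType) k : cmod (k%:R : R[i]) = k%:R.
Proof.
have -> : (k%:R : R[i]) = (k%:R : R)%:C%C by rewrite rmorph_nat.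
by rewrite cmod_real ger0_norm.
Qed.

Lemma cmodD (R : realType) (v w : R[i]) : cmod (v + w) <= cmod v + cmod w.
Proof. exact: le_normcD. Qed.

Lemma cmod_sum (R : realType) (I : Type) (s : seq I) (P : pred I)
    (F : I -> R[i]) :
  cmod (\sum_(i <- s | P i) F i) <= \sum_(i <- s | P i) cmod (F i).
Proof.
elim/big_ind2: _ => [|x1 x2 y1 y2 h1 h2|//]; first by rewrite cmod0.
exact: le_trans (cmodD _ _) (lerD h1 h2).
Qed.

Lemma cmod_prod (R : realType) (I : Type) (s : seq I) (P : pred I)
    (F : I -> R[i]) :
  cmod (\prod_(i <- s | P i) F i) = \prod_(i <- s | P i) cmod (F i).
Proof. by apply: big_morph; [exact: cmodM | exact: cmod1]. Qed.

Lemma Re_sum (R : realType) (I : Type) (s : seq I) (P : pred I)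
    (F : I -> R[i]) :
  complex.Re (\sum_(i <- s | P i) F i) = \sum_(i <- s | P i) complex.Re (F i).
Proof. by apply: (big_morph (@complex.Re R)) => // -[a b] [c d]. Qed.

Lemma normRe_cmod (R : realType) (w : R[i]) : `|complex.Re w| <= cmod w.
Proof.
by rewrite cmodE -sqrtr_sqr ler_wsqrtr // lerDl sqr_ge0.
Qed.

Lemma mulcJ_cmod (R : realType) (w : R[i]) :
  w * (w^*)%C = (cmod w ^+ 2)%:C%C.
Proof.
rewrite cmod_sqr; case: w => a b /=; apply/eqP; rewrite eq_complex /=.
by apply/andP; split; apply/eqP; ring.
Qed.

Lemma cmod_conj (R : realType) (w : R[i]) : cmod (w^*)%C = cmod w.
Proof. by rewrite !cmodE; case: w => a b /=; rewrite sqrrN. Qed.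

Lemma conj_unit (R : realType) (w : R[i]) :
  cmod w = 1 -> (w^*)%C = w^-1.
Proof.
move=> h; have w0 : w != 0 by rewrite -cmod_eq0 h oner_eq0.
by apply: (mulfI w0); rewrite mulcJ_cmod h expr1n mulfV.
Qed.

(** [X ^ N - 1] splits over the closed field [R[i]] and is separable, so it has [N] distinct roots,
    which forces a primitive one among them. *)
Lemma prim_root_exists (R : realType) N :
  (0 < N)%N -> exists w : R[i], N.-primitive_root w.
Proof.
move=> n_gt0; pose p : {poly R[i]} := 'X^N - 1.
have [r Dp] := closed_field_poly_normal p.
move: Dp; rewrite (monicP _) ?monicXnsubC // scale1r => Dp.
have rn1 : all N.-unity_root r by apply/allP => z; rewrite -root_prod_XsubC -Dp.
have sz_r : (N <= size r)%N.
  by rewrite -ltnS -(size_prod_XsubC r id) -Dp size_XnsubC.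
have [|z] := hasP (has_prim_root n_gt0 rn1 _ sz_r); last by exists z.
by rewrite -separable_prod_XsubC -Dp separable_Xn_sub_1 // pnatr_eq0 -lt0n.
Qed.

Lemma cmod_prim_root (R : realType) N (w : R[i]) :
  (0 < N)%N -> N.-primitive_root w -> cmod w = 1.
Proof.
move=> N0 /prim_expr_order h; apply/eqP.
by rewrite -(@pexpr_eq1 _ _ N) ?cmod_ge0 // -cmodX h cmod1.
Qed.

(** A geometric sum of ratio [w ^ (a - b)]; as [a] and [b] are below [N], the ratio is 1 only for
    [a = b]. *)
Lemma sum_prim_root (R : realType) N (w : R[i]) (a b : nat) :
  (0 < N)%N -> N.-primitive_root w -> (a < N)%N -> (b < N)%N ->
  \sum_(s < N) w ^+ (s * a) * ((w ^+ (s * b))^*)%C = (a == b)%:R * N%:R.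
Proof.
move=> N0 pw aN bN.
have w1 := cmod_prim_root N0 pw.
have w0 : w != 0 by rewrite -cmod_eq0 w1 oner_eq0.
pose y := w ^+ a / w ^+ b.
rewrite (eq_bigr (fun s : 'I_N => y ^+ s)); last first.
  move=> s _; rewrite conj_unit ?cmodX ?w1 ?expr1n //.
  by rewrite /y exprMn exprVn -!exprM !(mulnC s).
have yN : y ^+ N = 1.
  rewrite /y exprMn exprVn -!exprM !(mulnC _ N) !exprM.
  by rewrite (prim_expr_order pw) !expr1n invr1 mulr1.
have [ab|ab] := eqVneq a b.
  rewrite /y ab mulfV ?expf_neq0 // mul1r.
  by rewrite (eq_bigr (fun=> 1)) => [|i _]; rewrite ?expr1n // sumr_const card_ord.
have y1 : y - 1 != 0.
  rewrite subr_eq0; apply: contra_neq ab => y1.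
  have : w ^+ a = w ^+ b by rewrite -(divfK (expf_neq0 b w0) (w ^+ a)) -/y y1 mul1r.
  by move=> /eqP; rewrite (eq_prim_root_expr pw) /eqn !modn_small // => /eqP.
rewrite mul0r; apply: (mulfI y1).
by rewrite -subrX1 yN subrr mulr0.
Qed.

(** The orthogonal family is abstract because both the monomials on the torus and the rows of the
    Fourier matrix are instances. *)
Lemma parseval (R : realType) (T I : finType) (P : pred I)
    (chi : I -> T -> R[i]) (A : R) (d : I -> R[i]) :
  (forall i j, P i -> P j ->
     \sum_t chi i t * ((chi j t)^*)%C = (i == j)%:R * A%:C%C) ->
  \sum_t cmod (\sum_(i | P i) d i * chi i t) ^+ 2 =
  A * \sum_(i | P i) cmod (d i) ^+ 2.
Proof.
move=> h; apply: (@complexI R).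
rewrite rmorph_sum rmorphM rmorph_sum /=.
transitivity (\sum_t \sum_(i | P i) \sum_(j | P j)
    d i * ((d j)^*)%C * (chi i t * ((chi j t)^*)%C)).
  apply: eq_bigr => t _; rewrite -mulcJ_cmod rmorph_sum mulr_suml.
  apply: eq_bigr => i _; rewrite mulr_sumr; apply: eq_bigr => j _.
  by rewrite rmorphM /=; ring.
rewrite exchange_big mulr_sumr; apply: eq_bigr => i Pi.
rewrite exchange_big /=.
have E j : P j -> \sum_t d i * ((d j)^*)%C * (chi i t * ((chi j t)^*)%C) =
    d i * ((d j)^*)%C * ((i == j)%:R * A%:C%C).
  by move=> Pj; rewrite -mulr_sumr h.
rewrite (eq_bigr _ E) (bigD1 i) //= eqxx mul1r.
rewrite [X in _ + X]big1 => [|j /andP[Pj ji]].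
  by rewrite addr0 mulcJ_cmod mulrC.
by rewrite eq_sym (negbTE ji) mul0r mulr0.
Qed.

(** * Polynomials on the discrete torus *)

Lemma sqr_sum_le (R : realType) (I : finType) (P : pred I) (a : I -> R) :
  (\sum_(i | P i) a i) ^+ 2 <= #|P|%:R * \sum_(i | P i) a i ^+ 2.
Proof.
set S := \sum_(i | P i) a i; set Q := \sum_(i | P i) a i ^+ 2.
have Q0 : 0 <= Q by apply: sumr_ge0 => i _; exact: sqr_ge0.
case: (posnP #|P|) => [P0|P0].
  rewrite /S big1 ?expr0n ?mulr_ge0 // => i Pi.
  by move/card0_eq/(_ i): P0; rewrite unfold_in Pi.
set K : R := #|P|%:R; have K0 : 0 < K by rewrite ltr0n.
(* Sum [2 c a_i <= c ^ 2 + a_i ^ 2] with [c] the mean [S / K]. *)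
have : 2 * (S / K) * S <= K * (S / K) ^+ 2 + Q.
  rewrite {2}/S mulr_sumr /Q.
  have -> : K * (S / K) ^+ 2 = \sum_(i | P i) (S / K) ^+ 2.
    by rewrite sumr_const -[RHS]mulr_natl.
  rewrite -big_split /=; apply: ler_sum => i _.
  have := sqr_ge0 (S / K - a i); nra.
have -> : 2 * (S / K) * S = 2 * (S ^+ 2 / K) by ring.
have -> : K * (S / K) ^+ 2 = S ^+ 2 / K by field; rewrite gt_eqF.
move=> h; rewrite mulrC -ler_pdivrMr //; lra.
Qed.

(* Pointwise, [u ^ 2 <= t u + u ^ 4 / t ^ 2]; take [t = 2 B s]. *)
Lemma l2_le_l1_of_l4 (R : realType) (T : finType) (u : T -> R) (W B s : R) :
  (forall t, 0 <= u t) -> 0 < W -> 0 < B -> 0 <= s ->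
  \sum_t u t ^+ 2 = W * s ^+ 2 -> \sum_t u t ^+ 4 <= W * B ^+ 2 * s ^+ 4 ->
  W * s <= 4 * B * \sum_t u t.
Proof.
move=> u0 W0 B0 s0 h2 h4.
have U0 : 0 <= \sum_t u t by apply: sumr_ge0.
move: s0; rewrite le_eqVlt => /predU1P[<-|s0].
  by rewrite mulr0 !mulr_ge0 // ltW.
have t0 : 0 < 2 * B * s by rewrite !mulr_gt0.
have pw x (x0 : 0 <= x) : x ^+ 2 <= 2 * B * s * x + x ^+ 4 / (2 * B * s) ^+ 2.
  have [xt|tx] := leP x (2 * B * s).
    have /ler_wpDr -> // : 0 <= x ^+ 4 / (2 * B * s) ^+ 2.
      by rewrite divr_ge0 ?exprn_ge0 // ltW.
    by rewrite expr2 ler_wpM2r.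
  apply: ler_wpDl; first by rewrite mulr_ge0 // ltW.
  rewrite ler_pdivlMr ?exprn_gt0 // (exprD x 2 2).
  apply: ler_wpM2l; first exact: sqr_ge0.
  by apply: lerXn2r; rewrite ?nnegrE // ltW.
have : \sum_t u t ^+ 2 <=
    2 * B * s * (\sum_t u t) + (\sum_t u t ^+ 4) / (2 * B * s) ^+ 2.
  rewrite mulr_sumr mulr_suml -big_split /=.
  by apply: ler_sum => t _; exact: pw.
rewrite h2 => h.
have h5 : (\sum_t u t ^+ 4) / (2 * B * s) ^+ 2 <= W * s ^+ 2 / 4.
  rewrite ler_pdivrMr ?exprn_gt0 //; apply: (le_trans h4).
  by rewrite le_eqVlt; apply/orP; left; apply/eqP; field.
have h6 : s * (3 * W * s) <= s * (8 * B * \sum_t u t) by nra.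
rewrite ler_pM2l // in h6; nra.
Qed.

(** Averages over this grid replace integrals over the torus; monomials with exponents below [N]
    stay orthogonal on it. *)
Definition torus_pt (R : realType) (n N : nat) (w : R[i])
  (t : {ffun 'I_n -> 'I_N}) : 'I_n -> R[i] := fun v => w ^+ t v.

Lemma mono_orth (R : realType) (n N : nat) (w : R[i]) (e e' : 'I_n -> nat) :
  (0 < N)%N -> N.-primitive_root w ->
  (forall v, (e v < N)%N) -> (forall v, (e' v < N)%N) ->
  \sum_(t : {ffun 'I_n -> 'I_N})
     mono (torus_pt w t) e * ((mono (torus_pt w t) e')^*)%C =
  [forall v, e v == e' v]%:R * ((N ^ n)%:R : R)%:C%C.
Proof.
move=> N0 pw eN eN'.
rewrite (eq_bigr (fun t : {ffun 'I_n -> 'I_N} => \prod_v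
    (w ^+ (t v * e v) * ((w ^+ (t v * e' v))^*)%C))); last first.
  move=> t _; rewrite /mono rmorph_prod -big_split /=.
  by apply: eq_bigr => v _; rewrite -!exprM.
rewrite -(bigA_distr_bigA (fun v (s : 'I_N) =>
    w ^+ (s * e v) * ((w ^+ (s * e' v))^*)%C)).
rewrite (eq_bigr (fun v => (e v == e' v)%:R * N%:R)); last first.
  by move=> v _; rewrite sum_prim_root.
rewrite big_split /= prodr_const card_ord rmorph_nat natrX; congr (_ * _).
case: forallP => [h|h].
  by rewrite big1 // => v _; rewrite h.
have /existsP[v hv] : [exists v, e v != e' v].
  by rewrite -negb_forall; apply/negP => /forallP.
by rewrite (bigD1 v) //= (negbTE hv) mul0r.
Qed.

Lemma torus_parseval (R : realType) (n N : nat) (w : R[i]) (I : finType)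
    (P : pred I) (e : I -> 'I_n -> nat) (d : I -> R[i]) :
  (0 < N)%N -> N.-primitive_root w ->
  (forall i v, P i -> (e i v < N)%N) ->
  (forall i j, P i -> P j -> e i =1 e j -> i = j) ->
  \sum_(t : {ffun 'I_n -> 'I_N})
     cmod (\sum_(i | P i) d i * mono (torus_pt w t) (e i)) ^+ 2 =
  (N ^ n)%:R * \sum_(i | P i) cmod (d i) ^+ 2.
Proof.
move=> N0 pw eN einj.
apply: (parseval (chi := fun i t => mono (torus_pt w t) (e i))) => i j Pi Pj.
rewrite mono_orth //; [congr (_%:R * _) | by move=> v; exact: eN..].
have [<-|ij] := eqVneq i j; first by congr nat_of_bool; apply/forallP.
congr nat_of_bool; apply/negbTE; apply: contra_neqN ij => /forallP h.
by apply: einj => // v; apply/eqP.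
Qed.

(** These are divisors of the monomial [z ^ g]: each variable leaves at most [g v + 1 <= 2 ^ (g v)]
    choices. *)
Lemma card_ffun_le (n N : nat) (g : 'I_n -> nat) :
  (#|[pred f : {ffun 'I_n -> 'I_N} | [forall v, f v <= g v]]| <=
   2 ^ (\sum_v g v))%N.
Proof.
rewrite (eq_card (B := family (fun v => [pred a : 'I_N | a <= g v]%N))); last first.
  move=> f; rewrite [LHS]unfold_in /=.
  by apply/forallP/familyP => h v; have := h v; rewrite inE.
rewrite card_family foldrE big_map.
rewrite big_enum /= expn_sum.
apply: leq_prod => v _.
apply: (@leq_trans (g v).+1); last exact: ltn_expl.
rewrite -[leqRHS]card_ord.
rewrite -(card_in_image (f := fun a : 'I_N => inord a : 'I_(g v).+1)).
  exact: max_card.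
move=> a b; rewrite ![_ \in _]unfold_in => ha hb /(congr1 val).
by rewrite /= !inordK ?ltnS // => /val_inj.
Qed.

(** In a factorization of [z ^ g] into two monomials of the family, the first factor divides [z ^ g]
    and determines the second, while [g] has degree at most [2 k]. *)
Lemma card_pairs_le (n N k : nat) (I : finType) (P : pred I)
    (e : I -> 'I_n -> nat) (g : 'I_n -> nat) :
  (forall i v, P i -> (e i v < N)%N) ->
  (forall i j, P i -> P j -> e i =1 e j -> i = j) ->
  (forall i, P i -> (\sum_v e i v <= k)%N) ->
  (#|[pred u : I * I | [&& P u.1, P u.2 &
       [forall v, e u.1 v + e u.2 v == g v]]]| <= 2 ^ (2 * k))%N.
Proof.
move=> eN einj ek; set A := [pred u | _].
have [u0 Au0|A0] := pickP A; last by rewrite eq_card0.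
have gk : (\sum_v g v <= 2 * k)%N.
  case/and3P: Au0 => h1 h2 /forallP h3.
  rewrite -(eq_bigr _ (fun v _ => eqP (h3 v))) big_split /= mul2n -addnn.
  by rewrite leq_add ?ek.
apply: (@leq_trans (2 ^ (\sum_v g v))); last by rewrite leq_exp2l.
apply: leq_trans (@card_ffun_le n N.+1 g).
rewrite -(card_in_image
  (f := fun u : I * I => [ffun v => inord (e u.1 v)] : {ffun 'I_n -> 'I_N.+1})).
  apply: subset_leq_card; apply/fintype.subsetP => f /mapP[u + ->].
  rewrite mem_enum => Au.
  rewrite inE; apply/forallP => v.
  case/and3P: Au => h1 h2 /forallP h3.
  rewrite ffunE inordK ?ltnS; first by rewrite -(eqP (h3 v)) leq_addr.
  by rewrite ltnW // eN.
move=> [i i'] [j j'] /and3P[/= h1 h2 /forallP h3] /and3P[/= h4 h5 /forallP h6].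
move=> /ffunP h.
have ij v : e i v = e j v.
  have := congr1 val (h v); rewrite !ffunE /= !inordK // ltnS ltnW ?eN //.
have -> : i = j by exact: einj.
congr (_, _); apply: einj => // v; apply: (@addnI (e i v)).
by rewrite (eqP (h3 v)) -(eqP (h6 v)) ij.
Qed.

Lemma mono_add (R : realType) (n : nat) (z : 'I_n -> R[i]) (a b : 'I_n -> nat) :
  mono z (fun v => a v + b v)%N = mono z a * mono z b.
Proof. by rewrite /mono -big_split; apply: eq_bigr => v _; rewrite exprD. Qed.

Lemma mono_ext (R : realType) (n : nat) (z : 'I_n -> R[i]) (a b : 'I_n -> nat) :
  a =1 b -> mono z a = mono z b.
Proof. by move=> h; apply: eq_bigr => v _; rewrite h. Qed.

(* The square of the polynomial is again a polynomial; each of its coefficients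
   collects at most [4 ^ k] products of two coefficients. *)
Lemma torus_fourth (R : realType) (n N k : nat) (w : R[i]) (I : finType)
    (P : pred I) (e : I -> 'I_n -> nat) (d : I -> R[i]) :
  (2 * k < N)%N -> N.-primitive_root w ->
  (forall i j, P i -> P j -> e i =1 e j -> i = j) ->
  (forall i, P i -> (\sum_v e i v <= k)%N) ->
  \sum_(t : {ffun 'I_n -> 'I_N})
     cmod (\sum_(i | P i) d i * mono (torus_pt w t) (e i)) ^+ 4 <=
  (N ^ n)%:R * (2 ^ k)%:R ^+ 2 * (\sum_(i | P i) cmod (d i) ^+ 2) ^+ 2.
Proof.
case: N => // N kN pw einj ek.
have ekv i v : P i -> (e i v <= k)%N.
  by move=> Pi; apply: leq_trans (ek i Pi); rewrite (bigD1 v) //= leq_addr.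
(* Products are sorted by their exponent. Its entries are at most [2 k], below the order of [w], so
   [inord] truncates nothing and distinct exponents stay orthogonal. *)
pose g (u : I * I) : {ffun 'I_n -> 'I_N.+1} :=
  [ffun v => inord (e u.1 v + e u.2 v)].
have gE u v : P u.1 -> P u.2 -> g u v = (e u.1 v + e u.2 v)%N :> nat.
  move=> h1 h2; rewrite ffunE inordK //.
  by apply: leq_ltn_trans kN; rewrite mul2n -addnn leq_add ?ekv.
pose A (c : {ffun 'I_n -> 'I_N.+1}) := [pred u : I * I |
  (P u.1 && P u.2) && (g u == c)].
pose D c := \sum_(u | A c u) d u.1 * d u.2.
rewrite (eq_bigr (fun t => cmod (\sum_c D c *
    mono (torus_pt w t) (fun v => c v : nat)) ^+ 2)); last first.
  move=> t _; rewrite (_ : 4 = 2 * 2)%N // exprM -cmodX; congr (cmod _ ^+ 2).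
  rewrite expr2 mulr_suml.
  under eq_bigr do rewrite mulr_sumr.
  rewrite pair_big /= (partition_big g predT) //=.
  apply: eq_bigr => c _; rewrite /D mulr_suml; apply: eq_bigr => u /andP[].
  move=> /andP[h1 h2] /eqP gu.
  rewrite mulrACA -mono_add; congr (_ * _); apply: mono_ext => v.
  by rewrite -gu gE.
rewrite (torus_parseval (e := fun (c : {ffun 'I_n -> 'I_N.+1}) v => c v : nat)) //; last first.
  by move=> c c' _ _ h; apply/ffunP => v; apply/val_inj/h.
rewrite -mulrA ler_wpM2l // -natrX -expnM mulnC.
have -> : (\sum_(i | P i) cmod (d i) ^+ 2) ^+ 2 =
    \sum_c \sum_(u | A c u) cmod (d u.1 * d u.2) ^+ 2.
  rewrite expr2 mulr_suml; under eq_bigr do rewrite mulr_sumr.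
  rewrite pair_big /= (partition_big g predT) //=.
  apply: eq_bigr => c _; apply: eq_bigr => u _; by rewrite cmodM exprMn.
rewrite mulr_sumr; apply: ler_sum => c _.
apply: (@le_trans _ _ ((\sum_(u | A c u) cmod (d u.1 * d u.2)) ^+ 2)).
  by apply: lerXn2r; rewrite ?nnegrE ?cmod_ge0 ?cmod_sum // sumr_ge0 // => u _;
    exact: cmod_ge0.
apply: (le_trans (sqr_sum_le _ _)); apply: ler_wpM2r.
  by apply: sumr_ge0 => u _; exact: sqr_ge0.
rewrite ler_nat; apply: leq_trans (@card_pairs_le n N.+1 k I P e (fun v => c v) _ einj ek).
  apply: subset_leq_card; apply/fintype.subsetP => u /andP[/andP[h1 h2] /eqP gu].
  by rewrite !inE h1 h2; apply/forallP => v; rewrite -gu gE.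
move=> i v Pi; apply: leq_ltn_trans (ekv i v Pi) _.
by apply: leq_ltn_trans kN; rewrite leq_pmull.
Qed.

(** The second moment is given exactly by Parseval, and [torus_fourth] controls the fourth one with
    [B = 2 ^ k]. *)
Lemma torus_l2_le_l1 (R : realType) (n N k : nat) (w : R[i]) (I : finType)
    (P : pred I) (e : I -> 'I_n -> nat) (d : I -> R[i]) :
  (2 * k < N)%N -> N.-primitive_root w ->
  (forall i j, P i -> P j -> e i =1 e j -> i = j) ->
  (forall i, P i -> (\sum_v e i v <= k)%N) ->
  (N ^ n)%:R * Num.sqrt (\sum_(i | P i) cmod (d i) ^+ 2) <=
  4 * 2 ^+ k * \sum_(t : {ffun 'I_n -> 'I_N})
     cmod (\sum_(i | P i) d i * mono (torus_pt w t) (e i)).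
Proof.
move=> kN pw einj ek; set S := \sum_(i | P i) _.
have S0 : 0 <= S by apply: sumr_ge0 => i _; exact: sqr_ge0.
have N0 : (0 < N)%N by apply: leq_ltn_trans kN.
apply: l2_le_l1_of_l4; rewrite ?sqrtr_ge0 ?exprn_gt0 //.
- by move=> t; exact: cmod_ge0.
- by rewrite ltr0n expn_gt0 N0.
- rewrite sqr_sqrtr // (torus_parseval _ N0 pw) // => i v Pi.
  apply: leq_ltn_trans kN; apply: leq_trans (leq_pmull _ _) => //.
  by apply: leq_trans (ek i Pi); rewrite (bigD1 v) //= leq_addr.
- have -> : Num.sqrt S ^+ 4 = S ^+ 2 by rewrite (exprM _ 2 2) sqr_sqrtr.
  by rewrite -natrX; exact: torus_fourth.
Qed.

(** * Homogeneous parts of Caratheodory functions *)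

(** Fourier inversion: orthogonality isolates one coefficient, without aliasing because [p] has at
    most [N] of them. *)
Lemma coef_dft (R : realType) (N l : nat) (w : R[i]) (p : {poly R[i]}) :
  N.-primitive_root w -> (size p <= N)%N -> (l < N)%N ->
  \sum_(s < N) p.[w ^+ s] * ((w ^+ (s * l))^*)%C = N%:R * p`_l.
Proof.
move=> pw sp lN; have N0 : (0 < N)%N by apply: leq_ltn_trans lN.
under eq_bigr do rewrite (horner_coef_wide _ sp) mulr_suml.
rewrite exchange_big /=.
have E (i : 'I_N) : \sum_(s < N) p`_i * (w ^+ s) ^+ i * ((w ^+ (s * l))^*)%C =
    p`_i * ((i == l :> nat)%:R * N%:R).
  rewrite -(sum_prim_root N0 pw (ltn_ord i) lN) mulr_sumr.
  by apply: eq_bigr => s _; rewrite -exprM mulrA.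
rewrite (eq_bigr _ (fun i _ => E i)) (bigD1 (Ordinal lN)) //= eqxx mul1r.
rewrite big1 => [|i il]; first by rewrite addr0 mulrC.
have -> : (i == l :> nat) = false by exact: (negbTE il).
by rewrite mul0r mulr0.
Qed.

(** Cauchy's estimate, the contour integral being an average over sufficiently many roots of
    unity. *)
Lemma coef_le_circle (R : realType) (p : {poly R[i]}) (A : R) (l : nat) :
  (forall u : R[i], cmod u = 1 -> cmod p.[u] <= A) -> cmod p`_l <= A.
Proof.
move=> hA; pose N := (size p + l.+1)%N.
have N0 : (0 < N)%N by rewrite /N addnS.
have [w pw] := prim_root_exists R N0.
have w1 s : cmod (w ^+ s) = 1 by rewrite cmodX (cmod_prim_root N0 pw) expr1n.
have := coef_dft pw (leq_addr _ _) (leq_addl (size p) l.+1).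
move=> /(congr1 (@cmod R)); rewrite cmodM cmod_nat => E.
rewrite -(ler_pM2l (_ : 0 < N%:R)) ?ltr0n // -E.
apply: (le_trans (cmod_sum _ _ _)).
have -> : N%:R * A = \sum_(s < N) A by rewrite sumr_const card_ord mulr_natl.
by apply: ler_sum => s _; rewrite cmodM cmod_conj w1 mulr1 hA.
Qed.

(** The one-variable Caratheodory inequality. Adding to the Fourier sum for [p_l] the conjugate of
    the vanishing one for index [N - l] turns [p] into [2 Re p], which is nonnegative and has
    average [2 Re p_0]. *)
Lemma coef_le_of_Re_ge0 (R : realType) (p : {poly R[i]}) (l : nat) :
  (forall u : R[i], cmod u = 1 -> 0 <= complex.Re p.[u]) -> (0 < l)%N ->
  cmod p`_l <= 2 * complex.Re p`_0.
Proof.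
(* With this [N] the index [N - l] is [size p], just past the last coefficient. *)
move=> hp l0; pose N := (size p + l)%N.
have N0 : (0 < N)%N by rewrite /N ltn_addl.
have lN : (l <= N)%N by exact: leq_addl.
have [w pw] := prim_root_exists R N0.
have w1 s : cmod (w ^+ s) = 1 by rewrite cmodX (cmod_prim_root N0 pw) expr1n.
have [sp0|sp0] := posnP (size p).
  have -> : p = 0 by apply/eqP; rewrite -size_poly_eq0 sp0.
  by rewrite !coef0 cmod0 mulr0.
have lN' : (l < N)%N by rewrite /N -[ltnLHS]add0n ltn_add2r.
have spN : (size p <= N)%N by exact: leq_addr.
have E1 := coef_dft pw spN lN'.
have E2 : \sum_(s < N) p.[w ^+ s] * ((w ^+ (s * (N - l)))^*)%C = 0.
  rewrite (coef_dft pw spN); last by rewrite ltn_subrL l0.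
  by rewrite nth_default ?mulr0 // /N addnK.
have E : N%:R * p`_l = \sum_(s < N)
    ((2 * complex.Re p.[w ^+ s])%:C)%C * ((w ^+ (s * l))^*)%C.
  rewrite -E1 -[LHS]addr0 -[X in _ + X]conjc0 -[X in _ + (X^*)%C]E2 rmorph_sum.
  rewrite -big_split /=; apply: eq_bigr => s _.
  have -> : ((p.[w ^+ s] * ((w ^+ (s * (N - l)))^*)%C)^*)%C =
      ((p.[w ^+ s])^*)%C * ((w ^+ (s * l))^*)%C.
    rewrite rmorphM /= conjcK; congr (_ * _).
    rewrite conj_unit ?w1 // mulnBr exprB ?leq_mul2l ?lN ?orbT //; last first.
      by rewrite unitfE -cmod_eq0 (cmod_prim_root N0 pw) oner_eq0.
    by rewrite mulnC exprM (prim_expr_order pw) expr1n mul1r.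
  rewrite -mulrDl addcJ; congr (_ * _).
  by rewrite rmorphM /= rmorph_nat.
rewrite -(ler_pM2l (_ : 0 < N%:R)) ?ltr0n //.
rewrite -[leLHS]ger0_norm ?mulr_ge0 ?cmod_ge0 // -(cmod_nat R N) -cmodM.
rewrite ger0_norm ?cmod_ge0 // E.
apply: (le_trans (cmod_sum _ _ _)).
rewrite (eq_bigr (fun s : 'I_N => 2 * complex.Re p.[w ^+ s])); last first.
  move=> s _; rewrite cmodM cmod_conj w1 mulr1 cmod_real ger0_norm //.
  by rewrite mulr_ge0 // hp.
rewrite -mulr_sumr -Re_sum.
have := coef_dft pw spN N0; under eq_bigr do rewrite muln0 expr0 conjc1 mulr1.
move=> ->; rewrite cmod_nat mulrCA ler_pM2l // le_eqVlt; apply/orP; left; apply/eqP.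
have -> : (N%:R : R[i]) = (N%:R : R)%:C%C by rewrite rmorph_nat.
by case: (p`_0) => a b /=; rewrite mul0r subr0.
Qed.

Definition hpoly (R : realType) (n k : nat) (x : ('I_n -> nat) -> R[i])
    (z : 'I_n -> R[i]) : R[i] :=
  \sum_(a : {ffun 'I_n -> 'I_k.+1} | (\sum_(i < n) val (a i))%N == k)
    x (fun i => val (a i)) * mono z (fun i => val (a i)).

Lemma mono_scale (R : realType) (n : nat) (c : R[i]) (z : 'I_n -> R[i]) a :
  mono (fun v => c * z v) a = c ^+ (\sum_v a v) * mono z a.
Proof.
rewrite /mono -prodrXr -big_split /=.
by apply: eq_bigr => v _; rewrite exprMn.
Qed.

Lemma hpoly_scale (R : realType) (n k : nat) x (c : R[i]) (z : 'I_n -> R[i]) :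
  hpoly k x (fun v => c * z v) = c ^+ k * hpoly k x z.
Proof.
rewrite /hpoly mulr_sumr; apply: eq_bigr => a /eqP ak.
by rewrite mono_scale ak mulrCA.
Qed.

Lemma Re_hpoly (R : realType) (n k : nat) x (z : 'I_n -> R[i]) :
  hsum k (fun a => complex.Re (x a * mono z a)) = complex.Re (hpoly k x z).
Proof. by rewrite /hpoly Re_sum. Qed.

Lemma cmod_hpoly (R : realType) (n k : nat) x (z : 'I_n -> R[i]) :
  cmod (hpoly k x z) <= hsum k (fun a => cmod (x a * mono z a)).
Proof. exact: cmod_sum. Qed.

Lemma hsum_ge0 (R : realType) (n k : nat) (F : ('I_n -> nat) -> R) :
  (forall a, 0 <= F a) -> 0 <= hsum k F.
Proof. by move=> F0; apply: sumr_ge0. Qed.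

Lemma hpoly0 (R : realType) (n : nat) (x : ('I_n -> nat) -> R[i]) z :
  hpoly 0 x z = x (fun=> 0%N).
Proof.
rewrite /hpoly (big_pred1 [ffun=> ord0]) /=; last first.
  move=> a; apply/idP/eqP => [_|->].
    by apply/ffunP => v; rewrite ffunE; apply/val_inj; case: (a v) => -[].
  by rewrite big1 // => v _; rewrite ffunE.
rewrite (_ : (fun i => _) = fun=> 0%N); last first.
  by apply/funext => v; rewrite ffunE.
by rewrite /mono big1 ?mulr1 // => v _; rewrite expr0.
Qed.

Lemma nneseries_cvgn (R : realType) (u : R^nat) :
  (forall k, 0 <= u k) -> (\sum_(0 <= k <oo) (u k)%:E < +oo)%E ->
  cvgn (series u) /\ {homo series u : m k / (m <= k)%N >-> m <= k}.
Proof.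
move=> u0 hu.
have mono_u : {homo series u : m k / (m <= k)%N >-> m <= k}.
  by apply/nondecreasing_seqP => k; rewrite /series /= big_nat_recr //= lerDl.
split => //; apply: nondecreasing_is_cvgn => //.
have fin : (\sum_(0 <= k <oo) (u k)%:E)%E \is a fin_num.
  by rewrite ge0_fin_numE // nneseries_ge0 // => k _ _; rewrite lee_fin.
exists (fine (\sum_(0 <= k <oo) (u k)%:E)%E) => _ [m _ <-].
rewrite -lee_fin fineK // /series /= -sumEFin.
by apply: nneseries_lim_ge => k _ _; rewrite lee_fin.
Qed.

(** Truncate [t |-> f(t z)] at a degree [M] with absolute tail at most [e / 2]. The moduli of the
    terms are the same at [u z] for every unimodular [u], so adding [e / 2] makes the real part
    nonnegative on the whole circle, and the polynomial inequality gives [2 + e]. *)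
Lemma caratheodory_hpoly (R : realType) (n k : nat) x (z : 'I_n -> R[i]) :
  @caratheodory R n x -> @polydisk R n 1 z -> (0 < k)%N -> cmod (hpoly k x z) <= 2.
Proof.
move=> [x0 hx] hz k0; apply/ler_addgt0Pl => e e0.
pose h l := hsum l (fun a => cmod (x a * mono z a)).
have h0 l : 0 <= h l by apply: hsum_ge0 => a; exact: cmod_ge0.
have [cvh nd_h] := nneseries_cvgn h0 (hx z hz).1.
have e20 : 0 < e / 2 by rewrite divr_gt0.
have [M0 _ hM0] := cvgr_dist_lt _ _ cvh _ e20.
pose M := maxn M0 k.+1.
have hM m : series h m <= series h M + e / 2.
  apply: (le_trans (nondecreasing_cvgn_le nd_h cvh m)).
  have /= := hM0 M (leq_maxl _ _).
  by rewrite ltr_norml => /andP[_] /ltW; rewrite lerBlDl.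
pose p := \poly_(l < M) hpoly l x z + ((e / 2)%:C%C)%:P.
have M00 : (0 < M)%N by rewrite leq_max orbT.
have kM : (k < M)%N by rewrite leq_max leqnn orbT.
have -> : hpoly k x z = p`_k.
  by rewrite coefD coef_poly coefC kM -[k == 0%N]negbK -lt0n k0 /= addr0.
have -> : e + 2 = 2 * complex.Re p`_0.
  rewrite coefD coef_poly coefC M00 hpoly0 x0 /=; lra.
apply: coef_le_of_Re_ge0 => // u u1.
pose zu v := u * z v.
have hzu : @polydisk R n 1 zu by move=> v; rewrite cmodM u1 mul1r; exact: hz.
have huh l : hsum l (fun a => cmod (x a * mono zu a)) = h l.
  apply: eq_bigr => a _.
  by rewrite mono_scale !cmodM cmodX u1 expr1n mul1r.
have [_ pos] := hx zu hzu.
have eR : (fun l => hsum l (fun a => complex.Re (x a * mono zu a))) =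
    (fun l => complex.Re (u ^+ l * hpoly l x z)).
  by apply/funext => l; rewrite Re_hpoly hpoly_scale.
move: pos; rewrite eR; set v := fun l => complex.Re _ => pos.
have vh l : `|v l| <= h l.
  apply: (le_trans (normRe_cmod _)).
  by rewrite cmodM cmodX u1 expr1n mul1r; exact: cmod_hpoly.
have cv : cvgn (series v).
  apply: normed_cvg; apply: (series_le_cvg _ _ vh cvh) => l //.
have vM m : (M <= m)%N -> series v m <= series v M + e / 2.
  move=> Mm; rewrite -lerBlDl.
  apply: (@le_trans _ _ (series h m - series h M)); last by rewrite lerBlDl.
  rewrite !sub_series_geq //; apply: ler_sum => l _.
  exact: le_trans (ler_norm _) (vh l).
have lv : limn (series v) <= series v M + e / 2.
  by apply: limr_le => //; exists M => // m /= /vM.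
have -> : complex.Re p.[u] = series v M + e / 2.
  rewrite hornerD hornerC horner_poly /series /= big_mkord.
  transitivity (complex.Re (\sum_(i < M) hpoly i x z * u ^+ i) + e / 2).
    by case: (\sum_(i < M) _).
  by rewrite Re_sum; congr (_ + _); apply: eq_bigr => i _; rewrite mulrC.
exact: ltW (lt_le_trans pos lv).
Qed.

(** Roots of unity lie on the boundary, so the bound is needed on the closed polydisk; homogeneity
    carries it over from the points [(1 - h) z]. *)
Lemma hpoly_le2 (R : realType) (n k : nat) x (z : 'I_n -> R[i]) :
  @caratheodory R n x -> (forall v, cmod (z v) <= 1) -> (0 < k)%N ->
  cmod (hpoly k x z) <= 2.
Proof.
move=> hx hz k0; set A := cmod _.
have A0 : 0 <= A by exact: cmod_ge0.
rewrite leNgt; apply/negP => A2.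
(* For this [h], Bernoulli gives [(1 - h) ^ k * A >= (1 - k h) A = (A + 2) / 2 > 2], against the
   bound in the open polydisk. *)
pose h : R := (A - 2) / (2 * k%:R * A).
have k0' : (0 : R) < k%:R by rewrite ltr0n.
have Ap : 0 < A by lra.
have h0 : 0 < h by rewrite divr_gt0 ?subr_gt0 // !mulr_gt0.
have hk : k%:R * h * A = (A - 2) / 2 by rewrite /h; field; rewrite !gt_eqF.
have k1 : (1 : R) <= k%:R by rewrite ler1n.
have hA : h * A <= (A - 2) / 2.
  by rewrite -hk -mulrA ler_peMl // mulr_ge0 // ltW.
have h1 : h < 1 by rewrite -(ltr_pM2r Ap) mul1r; lra.
have h1' : 0 <= 1 - h by rewrite subr_ge0 ltW.
have bern m : 1 - m%:R * h <= (1 - h) ^+ m.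
  elim: m => [|m IH]; first by rewrite expr0 mul0r subr0.
  rewrite exprS -natr1; have := ler_wpM2l (_ : 0 <= 1 - h) IH.
  have m0 : (0 : R) <= m%:R by [].
  rewrite subr_ge0 ltW // => /(_ isT); nra.
have := @caratheodory_hpoly R n k x (fun v => (1 - h)%:C%C * z v) hx _ k0.
rewrite hpoly_scale cmodM cmodX cmod_real (ger0_norm h1') -/A => H.
have : (1 - h) ^+ k * A <= 2.
  apply: H => v; rewrite cmodM cmod_real (ger0_norm h1').
  have := hz v; have := cmod_ge0 (z v); nra.
have := ler_wpM2r A0 (bern k); nra.
Qed.

(** Average [|P_k| ^ 2 <= 4] over the grid of [k.+1]-th roots of unity, fine enough since all
    exponents are at most [k]. *)
Lemma hsum_sqr_le4 (R : realType) (n k : nat) (x : ('I_n -> nat) -> R[i]) :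
  @caratheodory R n x -> (0 < k)%N -> hsum k (fun a => cmod (x a) ^+ 2) <= 4.
Proof.
move=> hx k0.
have [w pw] := prim_root_exists R (ltn0Sn k).
have w1 := cmod_prim_root (ltn0Sn k) pw.
have W0 : (0 : R) < (k.+1 ^ n)%:R by rewrite ltr0n expn_gt0.
rewrite -(ler_pM2l W0) /hsum -(@torus_parseval R n k.+1 w _
  (fun a : {ffun 'I_n -> 'I_k.+1} => (\sum_(i < n) val (a i))%N == k)
  (fun (a : {ffun 'I_n -> 'I_k.+1}) i => val (a i))
  (fun a => x (fun i => val (a i)))) //; last first.
  by move=> a b _ _ h; apply/ffunP => v; apply/val_inj/h.
  by move=> a v _; exact: ltn_ord.
apply: (@le_trans _ _ (\sum_(t : {ffun 'I_n -> 'I_k.+1}) 4)); last first.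
  by rewrite sumr_const card_ffun !card_ord mulr_natl.
apply: ler_sum => t _; rewrite (_ : 4 = 2 ^+ 2); last by rewrite expr2; lra.
apply: lerXn2r; rewrite ?nnegrE ?cmod_ge0 //.
by apply: hpoly_le2 => // v; rewrite cmodX w1 expr1n.
Qed.

(** * Derivatives of the homogeneous parts *)

Lemma coef1_prod (A : comNzRingType) (I : eqType) (s : seq I) (q : I -> {poly A}) :
  uniq s -> (\prod_(v <- s) q v)`_1 =
  \sum_(j <- s) (q j)`_1 * \prod_(v <- s | v != j) (q v)`_0.
Proof.
elim: s => [|a s IH] /=; first by rewrite !big_nil coef1.
move=> /andP[as_ us]; rewrite !big_cons coefM !big_ord_recl big_ord0 /= addr0.
rewrite eqxx /= IH // addrC; congr (_ * _ + _).
  rewrite coef0_prod big_seq [RHS]big_seq_cond; apply: eq_bigl => v.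
  by case: (v \in s) (memPn as_ v) => // /(_ isT) ->.
rewrite mulr_sumr !big_seq; apply: eq_bigr => j js.
rewrite big_cons; case: eqVneq => [aj|_]; first by rewrite aj js in as_.
by rewrite mulrCA.
Qed.

Lemma coef_linear_exp (A : comNzRingType) (a b : A) (m : nat) :
  ((a%:P + b *: 'X) ^+ m)`_0 = a ^+ m /\
  ((a%:P + b *: 'X) ^+ m)`_1 = m%:R * a ^+ m.-1 * b.
Proof.
elim: m => [|m [IH0 IH1]]; first by rewrite !expr0 !coef1 /= mul0r mul0r.
split.
  by rewrite !exprS coefM big_ord1 /= IH0 coefD coefC coefZ coefX /= mulr0 addr0.
rewrite exprS coefM !big_ord_recl big_ord0 /= addr0 IH0 IH1 !coefD !coefC !coefZ.
rewrite !coefX /= mulr0 mulr1 addr0 add0r; case: m {IH0 IH1} => [|m] /=.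
  by rewrite !mul0r mulr0 add0r !mulr1 mul1r.
rewrite -[m.+2%:R]natr1 exprS; ring.
Qed.

(* The derivative of [hpoly k x] in [z_j]. *)
Definition dhpoly (R : realType) (n k : nat) (x : ('I_n -> nat) -> R[i])
    (j : 'I_n) (z : 'I_n -> R[i]) : R[i] :=
  \sum_(a : {ffun 'I_n -> 'I_k.+1} |
      ((\sum_(i < n) val (a i))%N == k) && (0 < a j)%N)
    ((a j)%:R * x (fun i => val (a i))) *
    mono z (fun v => a v - (v == j))%N.

(** By the Leibniz rule the sum is the first coefficient of [t |-> P_k(z + t w)]. For [|t| = 1] the
    argument is twice a point of the closed polydisk, so homogeneity bounds [P_k] by [2 * 2 ^ k] and
    Cauchy's estimate applies. *)
Lemma sum_dhpoly_le (R : realType) (n k : nat) x (z w : 'I_n -> R[i]) :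
  @caratheodory R n x -> (0 < k)%N ->
  (forall v, cmod (z v) <= 1) -> (forall v, cmod (w v) <= 1) ->
  cmod (\sum_j w j * dhpoly k x j z) <= 2 * 2 ^+ k.
Proof.
move=> hx k0 hz hw.
pose p := \sum_(a : {ffun 'I_n -> 'I_k.+1} | (\sum_(i < n) val (a i))%N == k)
  x (fun i => val (a i)) *: \prod_v ((z v)%:P + w v *: 'X) ^+ a v.
have -> : \sum_j w j * dhpoly k x j z = p`_1.
  rewrite coef_sum.
  under eq_bigr do rewrite mulr_sumr.
  rewrite (exchange_big_dep (fun a : {ffun 'I_n -> 'I_k.+1} =>
    (\sum_(i < n) val (a i))%N == k)) /=; last by move=> j a _ /andP[].
  apply: eq_bigr => a ak.
  rewrite coefZ coef1_prod ?index_enum_uniq // mulr_sumr.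
  rewrite big_mkcond [RHS]big_mkcond /=; apply: eq_bigr => j _.
  rewrite (coef_linear_exp _ _ _).2 ak /=.
  case: posnP => [->|aj]; first by rewrite !mul0r mulr0.
  rewrite /mono (bigD1 j) //= eqxx subn1.
  rewrite (eq_bigr (fun v => z v ^+ a v)) => [|v vj]; last first.
    by rewrite (negbTE vj) subn0.
  rewrite [in RHS](eq_bigr (fun v => z v ^+ a v)) => [|v vj]; last first.
    by rewrite (coef_linear_exp _ _ _).1.
  ring.
apply: coef_le_circle => u u1.
have -> : p.[u] = hpoly k x (fun v => 2 * ((z v + w v * u) / 2)).
  rewrite horner_sum; apply: eq_bigr => a _; rewrite hornerZ; congr (_ * _).
  rewrite horner_prod; apply: eq_bigr => v _.
  rewrite horner_exp hornerD hornerC hornerZ hornerX; congr (_ ^+ _).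
  by rewrite [RHS]mulrC divfK // pnatr_eq0.
rewrite hpoly_scale cmodM cmodX cmod_nat mulrC ler_wpM2r ?exprn_ge0 //.
apply: hpoly_le2 => // v.
rewrite cmodM cmodV cmod_nat ler_pdivrMr // mul1r.
apply: (le_trans (cmodD _ _)); rewrite cmodM u1 mulr1.
by have := hz v; have := hw v; lra.
Qed.

Lemma sum_cmod_dhpoly_le (R : realType) (n k : nat) x (z : 'I_n -> R[i]) :
  @caratheodory R n x -> (0 < k)%N -> (forall v, cmod (z v) <= 1) ->
  \sum_j cmod (dhpoly k x j z) <= 2 * 2 ^+ k.
Proof.
move=> hx k0 hz.
(* Phases that turn every term into its modulus. Where the derivative vanishes, division by zero
   yields [w j = 0], which is harmless. *)
pose w j : R[i] := ((dhpoly k x j z)^*)%C / (cmod (dhpoly k x j z))%:C%C.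
have hw v : cmod (w v) <= 1.
  rewrite /w cmodM cmodV cmod_conj cmod_real ger0_norm ?cmod_ge0 //.
  by have [->|h] := eqVneq (cmod (dhpoly k x v z)) 0; rewrite ?mul0r // divff.
apply: le_trans (sum_dhpoly_le hx k0 hz hw).
rewrite (_ : \sum_j w j * _ = (\sum_j cmod (dhpoly k x j z))%:C%C).
  by rewrite cmod_real ler_norm.
rewrite rmorph_sum; apply: eq_bigr => j _ /=.
rewrite /w.
have [h|h] := eqVneq (dhpoly k x j z) 0; first by rewrite h cmod0 !(mul0r, mulr0).
have c0 : (cmod (dhpoly k x j z))%:C%C != 0.
  by rewrite -cmod_eq0 cmod_real normr_eq0 cmod_eq0.
by rewrite mulrAC [X in X / _]mulrC mulcJ_cmod expr2 rmorphM mulfK.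
Qed.

(** By Parseval, the normalized [L^2] norm on the torus of the derivative of [P_k] in [z_j]. *)
Definition dnorm (R : realType) (n k : nat) (x : ('I_n -> nat) -> R[i])
    (j : 'I_n) : R :=
  Num.sqrt (\sum_(a : {ffun 'I_n -> 'I_k.+1} |
      ((\sum_(i < n) val (a i))%N == k) && (0 < a j)%N)
    cmod ((a j)%:R * x (fun i => val (a i))) ^+ 2).

(** Pass from [L^2] to [L^1] for each derivative, exchange the sum over [j] with the average, and
    apply [sum_cmod_dhpoly_le] at each grid point. The constant is [4 * 2 ^ k] times [2 * 2 ^ k]. *)
Lemma sum_dnorm_le (R : realType) (n k : nat) (x : ('I_n -> nat) -> R[i]) :
  @caratheodory R n x -> (0 < k)%N -> \sum_j dnorm k x j <= 8 * 4 ^+ k.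
Proof.
move=> hx k0; pose N := (2 * k).+1.
have [w pw] := prim_root_exists R (ltn0Sn (2 * k)).
have w1 := cmod_prim_root (ltn0Sn _) pw.
have W0 : (0 : R) < (N ^ n)%:R by rewrite ltr0n expn_gt0.
rewrite -(ler_pM2l W0) mulr_sumr.
apply: (@le_trans _ _ (\sum_j 4 * 2 ^+ k *
    \sum_(t : {ffun 'I_n -> 'I_N}) cmod (dhpoly k x j (torus_pt w t)))).
  apply: ler_sum => j _; apply: (torus_l2_le_l1 _ (leqnn _) pw).
    (* Lowering the [j]-th exponent is injective where that exponent is positive. *)
    move=> a b /andP[_ aj] /andP[_ bj] h; apply/ffunP => v; apply/val_inj.
    have := h v; case: eqVneq => [->|_]; last by rewrite !subn0.
    by rewrite !subn1 => /(congr1 S); rewrite !prednK.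
  move=> a /andP[/eqP ak _]; rewrite -[leqRHS]ak.
  by apply: leq_sum => v _; exact: leq_subr.
rewrite -mulr_sumr exchange_big /=.
apply: (@le_trans _ _ (4 * 2 ^+ k *
    \sum_(t : {ffun 'I_n -> 'I_N}) (2 * 2 ^+ k))).
  rewrite ler_wpM2l ?mulr_ge0 ?exprn_ge0 //; apply: ler_sum => t _.
  by apply: sum_cmod_dhpoly_le => // v; rewrite cmodX w1 expr1n.
rewrite sumr_const card_ffun !card_ord -(mulr_natl (2 * 2 ^+ k)).
rewrite (_ : (4 : R) ^+ k = 2 ^+ k * 2 ^+ k); last by rewrite -exprMn; congr (_ ^+ _); lra.
by rewrite le_eqVlt; apply/orP; left; apply/eqP; ring.
Qed.

(** * Coefficient bounds for p < 2 *)

Lemma sum_geometric_le (R : realType) (q : R) (m : nat) :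
  0 <= q -> (1 - q) * \sum_(a < m) q ^+ a <= 1.
Proof.
by move=> q0; rewrite -opprB mulNr -subrX1 opprB lerBlDr lerDl exprn_ge0.
Qed.

(* Compare with the generating function of the multi-indices. *)
Lemma card_deg_mul_le (R : realType) (n k : nat) (j : 'I_n) (q : R) :
  0 <= q <= 1 ->
  #|[pred a : {ffun 'I_n -> 'I_k.+1} |
      ((\sum_(i < n) val (a i))%N == k) && (0 < a j)%N]|%:R *
    (q ^+ k.-1 * (1 - q) ^+ n) <= 1.
Proof.
move=> /andP[q0 q1]; set P := [pred a | _].
(* Coordinate [j] must be positive, so one power of [q] is dropped there: an index in [P] gets
   weight [q ^ (k - 1)] and not [q ^ k]. *)
pose F (i : 'I_n) (a : 'I_k.+1) : R := if i == j then (0 < a)%N%:R * q ^+ a.-1 else q ^+ a.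
have F0 i a : 0 <= F i a.
  by rewrite /F; case: ifP => _; rewrite ?mulr_ge0 // exprn_ge0.
have F1 i : 0 <= (1 - q) * \sum_a F i a <= 1.
  apply/andP; split; first by apply: mulr_ge0; rewrite ?subr_ge0 //; apply: sumr_ge0.
  rewrite /F; case: (i == j); last exact: sum_geometric_le.
  rewrite big_ord_recl /= mul0r add0r.
  by under eq_bigr do rewrite mul1r; exact: sum_geometric_le.
have PF a : P a -> \prod_i F i (a i) = q ^+ k.-1.
  move=> /andP[/eqP ak aj].
  have -> : k.-1 = (\sum_i val (a i)).-1 by rewrite -[in LHS]ak.
  rewrite (bigD1 j) //= /F eqxx aj mul1r.
  rewrite (eq_bigr (fun i => q ^+ a i)) => [|i /negbTE->] //.
  rewrite prodrXr -exprD; congr (_ ^+ _).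
  by rewrite [in RHS](bigD1 j) //= -[in RHS](prednK aj) addSn.
apply: (@le_trans _ _ ((1 - q) ^+ n * \prod_i \sum_a F i a)); last first.
  rewrite -[X in _ ^+ X](card_ord n) -prodr_const -big_split /=.
  by apply: prodr_ile1 => i _; exact: F1.
rewrite bigA_distr_bigA /= mulrA [leLHS]mulrC ler_wpM2l ?exprn_ge0 ?subr_ge0 //.
rewrite mulr_natl -sumr_const [leRHS](bigID P) /= ler_wpDr //.
  by apply: sumr_ge0 => a _; apply: prodr_ge0.
by rewrite le_eqVlt; apply/orP; left; apply/eqP/eq_bigr => a /PF.
Qed.

(** Take [q = k / (n + k)]: then [1 / q = 1 + n / k] and [(1 - q) ^ (- n) = (1 + k / n) ^ n <= exp
    k]. *)
Lemma card_deg_le (R : realType) (n k : nat) (j : 'I_n) : (0 < k)%N ->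
  #|[pred a : {ffun 'I_n -> 'I_k.+1} |
      ((\sum_(i < n) val (a i))%N == k) && (0 < a j)%N]|%:R <=
  expR 1 ^+ k * (1 + n%:R / k%:R : R) ^+ k.-1.
Proof.
move=> k0; have n0 : (0 < n)%N by apply: leq_ltn_trans (ltn_ord j).
have kp : (0 : R) < k%:R by rewrite ltr0n.
have np : (0 : R) < n%:R by rewrite ltr0n.
pose q : R := k%:R / (n%:R + k%:R).
have d0 : (0 : R) < n%:R + k%:R by rewrite addr_gt0.
have q0 : 0 < q by rewrite divr_gt0.
have q1 : 1 - q = n%:R / (n%:R + k%:R).
  by rewrite /q; field; rewrite gt_eqF.
have q10 : 0 < 1 - q by rewrite q1 divr_gt0.
have := @card_deg_mul_le R n k j q; rewrite ltW //= -subr_ge0 ltW // => /(_ isT).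
rewrite -ler_pdivlMr ?mulr_gt0 ?exprn_gt0 // => h; apply: (le_trans h).
rewrite mul1r invfM mulrC -!exprVn; apply: ler_pM.
- by rewrite exprn_ge0 // invr_ge0 ltW.
- by rewrite exprn_ge0 // invr_ge0 ltW.
- have -> : (1 - q)^-1 = 1 + k%:R / n%:R.
    by rewrite q1; field; rewrite !gt_eqF.
  apply: (@le_trans _ _ (expR (k%:R / n%:R) ^+ n)).
    by apply: lerXn2r; rewrite ?nnegrE ?expR_ge0 ?expR_ge1Dx // addr_ge0 // divr_ge0.
  by rewrite -!expRM_natr divfK ?gt_eqF // mul1r.
- have -> // : q^-1 = 1 + n%:R / k%:R.
  by rewrite /q; field; rewrite !gt_eqF.
Qed.

Lemma powR_le1D (R : realType) (y t : R) : 0 <= y -> 0 <= t <= 1 -> y `^ t <= 1 + y.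
Proof.
move=> y0 /andP[t0 t1]; have [y1|/ltW y1] := leP y 1.
  apply: (@le_trans _ _ 1); last by rewrite lerDl.
  have := @ge0_ler_powR R t t0 y 1; rewrite !nnegrE powR1 => -> //.
by apply: (le_trans (ler1_powR y1 t1)); rewrite lerDr.
Qed.

(** Hoelder's inequality up to a factor 2: sum [y ^ t <= 1 + y] over [y = b_i / (S / M)], where [S]
    is the total. *)
Lemma sum_powR_concave_le (R : realType) (I : finType) (P : pred I) (b : I -> R)
    (t M : R) :
  (forall i, 0 <= b i) -> 0 < t <= 1 -> #|P|%:R <= M ->
  \sum_(i | P i) b i `^ t <= 2 * M `^ (1 - t) * (\sum_(i | P i) b i) `^ t.
Proof.
move=> b0 /andP[t0 t1] PM; set S := \sum_(i | P i) b i.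
have S0 : 0 <= S by apply: sumr_ge0.
have [S00|Sn0] := eqVneq S 0.
  rewrite big1 ?mulr_ge0 ?powR_ge0 // => i Pi.
  have /eqP := S00; rewrite psumr_eq0 // => /allP/(_ i (mem_index_enum _)).
  by rewrite Pi => /eqP ->; rewrite powR0 // gt_eqF.
have Sp : 0 < S by rewrite lt_neqAle eq_sym Sn0.
have K0 : (0 < #|P|)%N.
  rewrite lt0n; apply: contra_neqN Sn0 => /eqP/card0_eq P0.
  by rewrite /S big_pred0 // => i; have := P0 i; rewrite unfold_in.
have M0 : 0 < M by apply: lt_le_trans PM; rewrite ltr0n.
have c0 : 0 < S / M by rewrite divr_gt0.
apply: (@le_trans _ _ (\sum_(i | P i) (S / M) `^ t * (1 + b i / (S / M)))).
  apply: ler_sum => i _.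
  have -> : b i `^ t = (S / M) `^ t * (b i / (S / M)) `^ t.
    rewrite -powRM ?(ltW c0) //; first by rewrite mulrC divfK ?gt_eqF.
    by rewrite divr_ge0 ?(ltW c0).
  rewrite ler_wpM2l ?powR_ge0 // powR_le1D ?(ltW t0) //.
  by rewrite divr_ge0 ?(ltW c0).
rewrite -mulr_sumr big_split /= -mulr_suml -/S sumr_const.
have -> : S / (S / M) = M by field; rewrite !gt_eqF.
have -> : 2 * M `^ (1 - t) * S `^ t = (S / M) `^ t * (M + M).
  have E1 : M `^ (1 - t) * M `^ t = M.
    by rewrite -powRD ?subrK ?powRr1 ?(ltW M0) // (gt_eqF M0) implybT.
  have E2 : S `^ t = (S / M) `^ t * M `^ t.
    by rewrite -powRM ?(ltW M0) ?(ltW c0) // divfK // gt_eqF.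
  transitivity ((S / M) `^ t * (2 * (M `^ (1 - t) * M `^ t))).
    by rewrite E2; ring.
  by rewrite E1; ring.
by rewrite ler_wpM2l ?powR_ge0 // lerD2r.
Qed.

(** Write [b_i ^ p = b_i * b_i ^ (p - 1)] and bound the last factor by [S ^ (p - 1)]. *)
Lemma sum_powR_convex_le (R : realType) (I : finType) (b : I -> R) (p : R) :
  (forall i, 0 <= b i) -> 1 <= p -> \sum_i b i `^ p <= (\sum_i b i) `^ p.
Proof.
move=> b0 p1; set S := \sum_i b i.
have S0 : 0 <= S by apply: sumr_ge0.
have p0 : 0 < p by lra.
rewrite -(mulr_powRB1 S0 p0) {1}/S mulr_suml; apply: ler_sum => i _.
rewrite -(mulr_powRB1 (b0 i) p0) ler_wpM2l //.
apply: ge0_ler_powR; rewrite ?nnegrE ?subr_ge0 //.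
by rewrite /S (bigD1 i) //= lerDl sumr_ge0.
Qed.

Lemma sqr_powR_half (R : realType) (c p : R) : 0 <= c -> (c ^+ 2) `^ (p / 2) = c `^ p.
Proof.
by move=> c0; rewrite -powR_mulrn // -powRrM mulrC divfK // pnatr_eq0.
Qed.

(** Every index of positive degree has some [a j > 0], so its coefficient reappears in the
    derivative in [z_j], multiplied by [a j >= 1]. For fixed [j] the concave inequality with
    exponent [p / 2] applies to the squared moduli. *)
Lemma hsum_powR_le_dnorm (R : realType) (n k : nat) (x : ('I_n -> nat) -> R[i]) (p : R) :
  0 < p < 2 -> (0 < k)%N ->
  hsum k (fun a => cmod (x a) `^ p) <=
  2 * (expR 1 ^+ k * (1 + n%:R / k%:R) ^+ k.-1) `^ (1 - p / 2) *
  \sum_j dnorm k x j `^ p.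
Proof.
move=> /andP[p0 p2] k0.
pose P (a : {ffun 'I_n -> 'I_k.+1}) := (\sum_(i < n) val (a i))%N == k.
pose c (j : 'I_n) (a : {ffun 'I_n -> 'I_k.+1}) := cmod ((a j)%:R * x (fun i => val (a i))).
have c0 j a : 0 <= c j a by exact: cmod_ge0.
apply: (@le_trans _ _ (\sum_j \sum_(a | P a && (0 < a j)%N) c j a `^ p)).
  rewrite (exchange_big_dep P) /=; last by move=> j a _ /andP[].
  apply: ler_sum => a Pa.
  have [j aj] : exists j, (0 < a j)%N.
    apply/existsP; apply: contraLR k0; rewrite negb_exists => /forallP h.
    rewrite -eqn0Ngt; move: Pa; rewrite /P => /eqP <-; rewrite sum_nat_eq0.
    by apply/forallP => i; have := h i; rewrite -eqn0Ngt.
  rewrite (bigD1 j) /=; last by apply/andP.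
  apply: ler_wpDr; first by apply: sumr_ge0 => i _; exact: powR_ge0.
  apply: ge0_ler_powR; rewrite ?nnegrE ?cmod_ge0 ?(ltW p0) //.
  by rewrite /c cmodM cmod_nat ler_peMl ?cmod_ge0 // ler1n.
rewrite mulr_sumr; apply: ler_sum => j _.
rewrite -(sqr_powR_half p (sqrtr_ge0 _)) sqr_sqrtr; last first.
  by apply: sumr_ge0 => a _; exact: sqr_ge0.
under eq_bigr do rewrite -sqr_powR_half //.
apply: sum_powR_concave_le; last exact: card_deg_le.
  by move=> a; exact: sqr_ge0.
by apply/andP; split; lra.
Qed.

Lemma sum_powR_le (R : realType) (I : finType) (b : I -> R) (p : R) :
  (forall i, 0 <= b i) -> 0 < p ->
  \sum_i b i `^ p <= 2 * #|I|%:R `^ Num.max (1 - p) 0 * (\sum_i b i) `^ p.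
Proof.
move=> b0 p0; have [p1|/ltW p1] := leP p 1.
  rewrite max_l ?subr_ge0 //; apply: sum_powR_concave_le => //.
  by rewrite p0.
rewrite max_r ?subr_le0 // powRr0 mulr1.
apply: (le_trans (sum_powR_convex_le b0 p1)).
by rewrite ler_peMl ?powR_ge0 // ler1n.
Qed.

Lemma hsum_powR_le (R : realType) (n k : nat) (x : ('I_n -> nat) -> R[i]) (p : R) :
  0 < p < 2 -> (0 < k)%N -> @caratheodory R n x ->
  hsum k (fun a => cmod (x a) `^ p) <=
  4 * (expR 1 ^+ k * (1 + n%:R / k%:R) ^+ k.-1) `^ (1 - p / 2) *
  n%:R `^ Num.max (1 - p) 0 * (8 * 4 ^+ k) `^ p.
Proof.
move=> p02 k0 hx; apply: (le_trans (hsum_powR_le_dnorm x p02 k0)).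
have [p0 _] := andP p02.
set Q := _ `^ (1 - p / 2); have Q0 : 0 <= Q by exact: powR_ge0.
have d0 j : 0 <= dnorm k x j by exact: sqrtr_ge0.
have -> : 4 * Q * n%:R `^ Num.max (1 - p) 0 * (8 * 4 ^+ k) `^ p =
  2 * Q * (2 * n%:R `^ Num.max (1 - p) 0 * (8 * 4 ^+ k) `^ p) by ring.
rewrite ler_wpM2l ?mulr_ge0 //.
apply: (le_trans (sum_powR_le d0 p0)); rewrite card_ord.
rewrite ler_wpM2l ?mulr_ge0 ?powR_ge0 //.
apply: ge0_ler_powR; rewrite ?nnegrE ?(ltW p0) ?mulr_ge0 ?exprn_ge0 //.
  by apply: sumr_ge0.
exact: sum_dnorm_le.
Qed.

Lemma powR_exprn (R : realType) (a s : R) (k : nat) :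
  0 <= a -> (a ^+ k) `^ s = (a `^ s) ^+ k.
Proof.
by move=> a0; rewrite -powR_mulrn // powRAC powR_mulrn // powR_ge0.
Qed.

Lemma ln_nat_gt0 (R : realType) (n : nat) : (1 < n)%N -> 0 < ln (n%:R : R).
Proof. by move=> n1; rewrite ln_gt0 // ltr1n. Qed.

Lemma ln_nat_le (R : realType) (n : nat) : (1 < n)%N -> ln (n%:R : R) <= n%:R.
Proof.
move=> n1; have n0 : (0 : R) < n%:R by rewrite ltr0n ltnW.
have -> : (n%:R : R) = 1 + (n%:R - 1) by rewrite addrCA subrr addr0.
have h : -1 < n%:R - 1 :> R by lra.
by apply: (le_trans (le_ln1Dx h)); lra.
Qed.

(* With [y = ln n / k] the factor [(1 + n / k) ^ k] exceeds [(n / ln n) ^ k] by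
   at most [(1 + y) ^ k], and [1 + y <= K exp (d y)], where [exp (d y) ^ k = n ^ d]
   is exactly the gain [n ^ (s - e)] left in the bound. *)
Lemma numeric_le (R : realType) (n k : nat) (p s e : R) : (1 < n)%N -> (0 < k)%N ->
  0 < p < 2 -> 0 < s <= 1 -> 0 <= e < s ->
  4 * (expR 1 ^+ k * (1 + n%:R / k%:R) ^+ k.-1) `^ s * n%:R `^ e *
    (8 * 4 ^+ k) `^ p <=
  (2 ^+ 13 * expR 1 * Num.max 1 (s - e)^-1 * (n%:R / ln n%:R) `^ s) ^+ k.
Proof.
move=> n1 k0 /andP[p0 p2] /andP[s0 s1] /andP[e0 es].
set T := 1 + n%:R / k%:R; set L := ln n%:R; set nu := n%:R / L.
set E1 := expR 1; set K := Num.max 1 _; set d := s - e in K *.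
have kp : (0 : R) < k%:R by rewrite ltr0n.
have np : (0 : R) < n%:R by rewrite ltr0n ltnW.
have L0 : 0 < L by exact: ln_nat_gt0.
have Ln : L <= n%:R by exact: ln_nat_le.
have nu0 : 0 < nu by rewrite divr_gt0.
have T0 : 0 < T by rewrite addr_gt0 // divr_gt0.
have d0 : 0 < d by rewrite subr_gt0.
have E10 : 1 <= E1 by rewrite -expR0 ler_expR.
have K1 : 1 <= K by rewrite le_max lexx.
have Kd : 1 <= K * d by rewrite -ler_pdivrMr // mul1r le_max lexx orbT.
pose y := L / k%:R.
have y0 : 0 < y by rewrite divr_gt0.
have Ty : T <= nu * (1 + y).
  have -> : T = nu * (L / n%:R + y).
    by rewrite /T /nu /y; field; rewrite !gt_eqF.
  by rewrite ler_wpM2l ?(ltW nu0) // lerD2r ler_pdivrMr // mul1r.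
have yK : 1 + y <= K * expR (d * y).
  apply: (@le_trans _ _ (K * (1 + d * y))).
    by rewrite mulrDr mulr1 mulrA lerD // ler_peMl // ltW.
  by rewrite ler_wpM2l ?expR_ge1Dx // (le_trans ler01).
have yKk : (1 + y) ^+ k <= K ^+ k * n%:R `^ d.
  apply: (@le_trans _ _ ((K * expR (d * y)) ^+ k)).
    apply: lerXn2r => //; rewrite nnegrE ?addr_ge0 ?(ltW y0) //.
    by rewrite mulr_ge0 ?expR_ge0 // (le_trans ler01).
  rewrite exprMn -expRM_natr /powR (gt_eqF np) -mulrA.
  by rewrite /y divfK // gt_eqF.
(* As [T >= n / k], one has [T ^ (k - 1) <= T ^ k * (k / n)]: this is the factor [1 / n] gained from
   the exponent [k - 1]. *)
have QT : E1 ^+ k * T ^+ k.-1 <= (E1 ^+ k * k%:R * (1 + y) ^+ k) * nu ^+ k * n%:R^-1.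
  have -> : E1 ^+ k * k%:R * (1 + y) ^+ k * nu ^+ k / n%:R =
    E1 ^+ k * ((nu * (1 + y)) ^+ k * (k%:R / n%:R)).
    rewrite [(nu * _) ^+ k]exprMn.
    move: (E1 ^+ k) (nu ^+ k) ((1 + y) ^+ k) (k%:R : R) (n%:R : R)^-1.
    by move=> a b c f g; ring.
  rewrite ler_wpM2l ?exprn_ge0 ?(le_trans ler01 E10) //.
  apply: (@le_trans _ _ (T ^+ k * (k%:R / n%:R))); last first.
    rewrite ler_wpM2r ?divr_ge0 ?(ltW kp) ?(ltW np) //.
    by apply: lerXn2r => //; rewrite nnegrE ?(ltW T0) // mulr_ge0 ?(ltW nu0) // addr_ge0 // ltW.
  rewrite -{2}(prednK k0) exprSr -mulrA ler_peMr ?exprn_ge0 ?(ltW T0) //.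
  have -> : T * (k%:R / n%:R) = k%:R / n%:R + 1.
    by rewrite /T; field; rewrite !gt_eqF.
  by rewrite lerDr divr_ge0 // ltW.
set B := E1 ^+ k * k%:R * (1 + y) ^+ k in QT.
have B1 : 1 <= B.
  by rewrite /B !mulr_ege1 ?exprn_ege1 ?ler1n // lerDl ltW.
have B0 : 0 <= B by exact: le_trans ler01 B1.
(* Here [B ^ s <= B] because [B >= 1] and [s <= 1]. *)
have Qs : (E1 ^+ k * T ^+ k.-1) `^ s <= B * (nu `^ s) ^+ k * n%:R `^ (- s).
  apply: (@le_trans _ _ ((B * nu ^+ k * n%:R^-1) `^ s)).
    apply: ge0_ler_powR => //; rewrite ?nnegrE ?(ltW s0) //.
      by rewrite mulr_ge0 // exprn_ge0 // ?(ltW T0) // (le_trans ler01).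
    by rewrite divr_ge0 ?(ltW np) // (mulr_ge0 B0) // exprn_ge0 // ltW.
  rewrite powRM ?invr_ge0 ?(ltW np) //; last first.
    by rewrite (mulr_ge0 B0) // exprn_ge0 // ltW.
  rewrite powRM // ?exprn_ge0 ?(ltW nu0) // powR_exprn ?(ltW nu0) //.
  rewrite -(powR_inv1 (ltW np)) -powRrM mulN1r.
  by rewrite !ler_wpM2r ?powR_ge0 ?exprn_ge0 ?powR_ge0 // ler1_powR.
have k2 : (k%:R : R) <= 2 ^+ k by rewrite -natrX ler_nat ltnW // ltn_expl.
(* The factor [n ^ d] of [yKk] cancels against [n ^ (- s) * n ^ e], and the stray [k] is absorbed by
   [2 ^ k]. *)
have BK : B * n%:R `^ (- s) * n%:R `^ e <= (E1 * 2 * K) ^+ k.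
  have -> : B * n%:R `^ (- s) * n%:R `^ e = B * n%:R `^ (- d).
    rewrite -mulrA -powRD; first by rewrite /d opprB addrC.
    by rewrite (gt_eqF np) implybT.
  rewrite !exprMn /B -!mulrA ler_wpM2l ?exprn_ge0 ?(le_trans ler01 E10) //.
  apply: ler_pM => //.
    by rewrite mulr_ge0 ?powR_ge0 // exprn_ge0 // addr_ge0 // ltW.
  by rewrite powRN ler_pdivrMr ?powR_gt0.
(* Replace [p] by 2: [(8 * 4 ^ k) ^ 2 = 64 * 16 ^ k <= 1024 ^ k]. *)
have E8 : (8 * 4 ^+ k) `^ p <= (1024 : R) ^+ k.
  have h1 : (1 : R) <= 8 * 4 ^+ k.
    have : (1 : R) <= 4 ^+ k by rewrite exprn_ege1 // ler1n.
    lra.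
  apply: (@le_trans _ _ ((8 * 4 ^+ k) `^ 2%:R)).
    by apply: ler_powR => //; exact: ltW.
  rewrite powR_mulrn ?(le_trans ler01 h1) //.
  have -> : (1024 : R) ^+ k = (64 * 16) ^+ k by congr (_ ^+ _); lra.
  rewrite exprMn [leRHS]exprMn (_ : (4 ^+ k) ^+ 2 = (16 : R) ^+ k); last first.
    by rewrite -exprM mulnC exprM; congr (_ ^+ _); lra.
  rewrite ler_wpM2r ?exprn_ge0 // (_ : 8 ^+ 2 = (64 : R)); last by rewrite expr2; lra.
  by rewrite ler_eXnr // ler1n.
have E4 : (4 : R) <= 4 ^+ k by rewrite ler_eXnr // ler1n.
(* The constant [2 ^ 13] is [4 * 2 * 1024]. *)
have -> : (2 ^+ 13 * E1 * K * nu `^ s) ^+ k =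
   4 ^+ k * ((E1 * 2 * K) ^+ k * (nu `^ s) ^+ k) * 1024 ^+ k.
  by rewrite -!exprMn; congr (_ ^+ _); ring.
apply: ler_pM => //; rewrite ?mulr_ge0 ?powR_ge0 //.
rewrite -mulrA; apply: ler_pM => //; rewrite ?mulr_ge0 ?powR_ge0 //.
apply: (@le_trans _ _ ((B * (nu `^ s) ^+ k * n%:R `^ (- s)) * n%:R `^ e)).
  by rewrite ler_wpM2r ?powR_ge0.
have -> : B * (nu `^ s) ^+ k * n%:R `^ (- s) * n%:R `^ e =
  (B * n%:R `^ (- s) * n%:R `^ e) * (nu `^ s) ^+ k by ring.
by rewrite ler_wpM2r // exprn_ge0 // powR_ge0.
Qed.

Lemma coef_bound (R : realType) (p : R) : 0 < p < 2 ->
  exists2 A : R, 0 < A & forall (n k : nat) (x : ('I_n -> nat) -> R[i]),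
    (1 < n)%N -> (0 < k)%N -> @caratheodory R n x ->
    hsum k (fun a => cmod (x a) `^ p) <=
    (A * (n%:R / ln n%:R) `^ (1 - p / 2)) ^+ k.
Proof.
move=> p02; have [p0 p2] := andP p02.
exists (2 ^+ 13 * expR 1 * Num.max 1 (1 - p / 2 - Num.max (1 - p) 0)^-1).
  by rewrite mulr_gt0 ?mulr_gt0 ?expR_gt0 // lt_max ltr01.
move=> n k x n1 k0 hx; apply: (le_trans (hsum_powR_le p02 k0 hx)).
apply: numeric_le => //; first by lra.
(* The loss [max (1 - p, 0)] is below [1 - p / 2] exactly because [0 < p < 2]. *)
by rewrite le_max lexx orbT gt_max; lra.
Qed.

(** * Lower bounds *)

Lemma bohr_sum_le (R : realType) (n : nat) (p B : R) (x : ('I_n -> nat) -> R[i]) z :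
  x (fun=> 0%N) = 1 ->
  (forall M, \sum_(1 <= k < M) hsum k (fun a => cmod (x a * mono z a) `^ p) <= B - 1) ->
  (bohr_sum p x z <= B%:E)%E.
Proof.
move=> x0 h; rewrite /bohr_sum x0 cmod1 powR1.
have -> : B%:E = (1%:E + (B - 1)%:E)%E by rewrite -EFinD addrCA subrr addr0.
apply: leeD => //; apply: lime_le.
  by apply: is_cvg_nneseries => k _ _; rewrite lee_fin hsum_ge0 // => a; exact: powR_ge0.
by apply: nearW => M; rewrite sumEFin lee_fin.
Qed.

Lemma bohr_sum_ge (R : realType) (n M : nat) (p : R) (x : ('I_n -> nat) -> R[i]) z :
  x (fun=> 0%N) = 1 ->
  ((1 + \sum_(1 <= k < M) hsum k (fun a => cmod (x a * mono z a) `^ p))%:E <=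
   bohr_sum p x z)%E.
Proof.
move=> x0; rewrite /bohr_sum x0 cmod1 powR1 EFinD leeD2l // -sumEFin.
by apply: nneseries_lim_ge => k _ _; rewrite lee_fin hsum_ge0 // => a; exact: powR_ge0.
Qed.

Lemma bohr_sum_ge0 (R : realType) (n : nat) (p : R) (x : ('I_n -> nat) -> R[i]) z :
  (0 <= bohr_sum p x z)%E.
Proof.
apply: adde_ge0; first by rewrite lee_fin powR_ge0.
by apply: nneseries_ge0 => k _ _; rewrite lee_fin hsum_ge0 // => a; exact: powR_ge0.
Qed.

Lemma powR2V (R : realType) (p : R) : 0 < p -> (2 `^ p) `^ p^-1 = 2 :> R.
Proof. by move=> p0; rewrite -powRrM mulfV ?gt_eqF // powRr1. Qed.

Lemma powR2_gt1 (R : realType) (p : R) : 0 < p -> 1 < 2 `^ p :> R.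
Proof.
move=> p0; have := @gt0_ltr_powR R p p0 1 2.
by rewrite !nnegrE powR1; apply; rewrite ?ltr1n.
Qed.

(** With constant term 1 the defining condition says that the sum over positive degrees is at most
    [2 ^ p - 1]; testing partial sums is enough. *)
Lemma Hpf_ge (R : realType) (n : nat) (p r : R) (x : ('I_n -> nat) -> R[i]) :
  0 < p -> 0 <= r -> x (fun=> 0%N) = 1 ->
  (forall z M, @polydisk R n r z ->
   \sum_(1 <= k < M) hsum k (fun a => cmod (x a * mono z a) `^ p) <= 2 `^ p - 1) ->
  (r%:E <= Hpf p x)%E.
Proof.
move=> p0 r0 x0 h; apply: ereal_sup_ubound; exists r => //; split => // z zr.
have hb := bohr_sum_le x0 (fun M => h z M zr).
apply: (@le_trans _ _ ((2^-1)%:E * ((2 `^ p)%:E `^ p^-1))%E).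
  rewrite lee_pmul2l //; apply: gt0_ler_poweR; rewrite ?invr_ge0 ?(ltW p0) //.
    by rewrite in_itv /= bohr_sum_ge0 leey.
  by rewrite in_itv /= lee_fin powR_ge0 leey.
by rewrite poweR_EFin powR2V // -EFinM mulVf.
Qed.

Lemma Hpf_le (R : realType) (n : nat) (p u : R) (x : ('I_n -> nat) -> R[i]) :
  0 < p -> x (fun=> 0%N) = 1 ->
  (forall r, u < r -> 0 <= r -> exists2 z, @polydisk R n r z & exists M,
   2 `^ p - 1 < \sum_(1 <= k < M) hsum k (fun a => cmod (x a * mono z a) `^ p)) ->
  (Hpf p x <= u%:E)%E.
Proof.
move=> p0 x0 h; apply: ub_ereal_sup => _ [r [r0 hr] <-].
rewrite lee_fin leNgt; apply/negP => ur.
have [z zr [M hM]] := h r ur r0.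
have := hr z zr; apply/negP; rewrite -ltNge.
have hb := @bohr_sum_ge R n M p x z x0.
set t := 1 + _ in hb; have t2 : 2 `^ p < t by rewrite /t; lra.
have t0 : 0 <= t by apply: le_trans (ltW t2); exact: powR_ge0.
apply: (@lt_le_trans _ _ ((2^-1)%:E * (t%:E `^ p^-1))%E).
  rewrite poweR_EFin -EFinM lte_fin ltr_pdivlMl // mulr1.
  by rewrite -(powR2V p0); apply: gt0_ltr_powR; rewrite ?invr_gt0 ?nnegrE ?powR_ge0.
rewrite lee_pmul2l //; apply: gt0_ler_poweR; rewrite ?invr_ge0 ?(ltW p0) //.
  by rewrite in_itv /= lee_fin t0 leey.
by rewrite in_itv /= bohr_sum_ge0 leey.
Qed.

Lemma cmod_mono_le (R : realType) (n : nat) (r : R) (z : 'I_n -> R[i]) a :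
  @polydisk R n r z -> cmod (mono z a) <= r ^+ (\sum_v a v).
Proof.
move=> zr; rewrite /mono cmod_prod -prodrXr; apply: ler_prod => v _.
rewrite cmodX exprn_ge0 ?cmod_ge0 //=; apply: lerXn2r; rewrite ?nnegrE ?cmod_ge0 //.
  by apply: le_trans (ltW (zr v)); exact: cmod_ge0.
exact: ltW (zr v).
Qed.

Lemma hsum_polydisk_le (R : realType) (n k : nat) (p r : R)
    (x : ('I_n -> nat) -> R[i]) z :
  0 <= p -> 0 <= r -> @polydisk R n r z ->
  hsum k (fun a => cmod (x a * mono z a) `^ p) <=
  (r `^ p) ^+ k * hsum k (fun a => cmod (x a) `^ p).
Proof.
move=> p0 r0 zr; rewrite /hsum mulr_sumr; apply: ler_sum => a /eqP ak.
rewrite cmodM powRM ?cmod_ge0 // mulrC ler_wpM2r ?powR_ge0 // -powR_exprn //.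
apply: ge0_ler_powR; rewrite ?nnegrE ?cmod_ge0 ?exprn_ge0 //.
by have := cmod_mono_le (fun i => val (a i)) zr; rewrite ak.
Qed.

Lemma sum_geometric_from1_le (R : realType) (q : R) (M : nat) :
  0 <= q < 1 -> \sum_(1 <= k < M) q ^+ k <= q / (1 - q).
Proof.
move=> /andP[q0 q1]; rewrite ler_pdivlMr ?subr_gt0 //.
case: M => [|M]; first by rewrite big_geq // mul0r.
rewrite big_add1 /= big_mkord; under eq_bigr do rewrite exprS.
rewrite -mulr_sumr -mulrA mulrC [X in X * q]mulrC.
by have := ler_wpM2r q0 (sum_geometric_le M q0); rewrite mul1r.
Qed.

Lemma Hpn_lower_lt2 (R : realType) (p : R) : 0 < p < 2 ->
  exists2 C : R, 0 < C & forall n : nat, (1 < n)%N ->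
    ((C * (ln (n%:R) / n%:R) `^ ((2 - p) / (2 * p)))%:E <= @Hpn R n p)%E.
Proof.
move=> p02; have [p0 p2] := andP p02.
have [A A0 hA] := coef_bound p02.
have A1 : 1 < 2 `^ p :> R by exact: powR2_gt1.
(* Chosen so that [t / (1 - t) = 2 ^ p - 1]; the radius below makes the terms of degree [k] add up
   to at most [t ^ k]. *)
pose t : R := (2 `^ p - 1) / 2 `^ p.
have P0 : 0 < 2 `^ p :> R by rewrite powR_gt0.
have t0 : 0 < t by rewrite divr_gt0 // subr_gt0.
have t1 : t < 1 by rewrite ltr_pdivrMr // mul1r ltrBlDr ltrDl.
exists ((t / A) `^ p^-1); first by rewrite powR_gt0 // divr_gt0.
move=> n n1; apply: le_ereal_inf_tmp => _ [x hx <-].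
have L0 := @ln_nat_gt0 R n n1.
have np : (0 : R) < n%:R by rewrite ltr0n ltnW.
set r := _ * _; have r0 : 0 <= r by rewrite mulr_ge0 ?powR_ge0.
apply: Hpf_ge => //; first exact: hx.1.
move=> z M zr.
have rp : r `^ p = t / A * (ln n%:R / n%:R) `^ (1 - p / 2).
  rewrite /r powRM ?powR_ge0 // -!powRrM mulVf ?gt_eqF // powRr1; last first.
    by rewrite divr_ge0 // ltW.
  by congr (_ * _ `^ _); field; rewrite gt_eqF.
apply: (@le_trans _ _ (\sum_(1 <= k < M) t ^+ k)); last first.
  apply: (le_trans (@sum_geometric_from1_le _ t M _)); first by rewrite ltW.
  by rewrite le_eqVlt; apply/orP; left; apply/eqP; rewrite /t; field; rewrite gt_eqF //=; lra.
rewrite big_nat_cond [leRHS]big_nat_cond; apply: ler_sum => k /andP[/andP[k0 _] _].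
apply: (le_trans (hsum_polydisk_le k x (ltW p0) r0 zr)).
apply: (@le_trans _ _ ((r `^ p) ^+ k * (A * (n%:R / ln n%:R) `^ (1 - p / 2)) ^+ k)).
  by rewrite ler_wpM2l ?exprn_ge0 ?powR_ge0 // hA.
rewrite -exprMn rp le_eqVlt; apply/orP; left; apply/eqP; congr (_ ^+ _).
have -> : t / A * (ln n%:R / n%:R) `^ (1 - p / 2) * (A * (n%:R / ln n%:R) `^ (1 - p / 2)) =
  t * ((ln n%:R / n%:R) `^ (1 - p / 2) * (n%:R / ln n%:R) `^ (1 - p / 2)).
  by field; rewrite gt_eqF.
rewrite -powRM ?divr_ge0 ?(ltW L0) ?(ltW np) //.
have -> : ln n%:R / n%:R * (n%:R / ln n%:R) = 1 :> R by field; rewrite !gt_eqF.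
by rewrite powR1 mulr1.
Qed.

(** The square sum also bounds each single [|x_a|] by 2, so
    [|x_a| ^ p <= 2 ^ (p - 2) * |x_a| ^ 2]. *)
Lemma hsum_powR_le_ge2 (R : realType) (n k : nat) (p : R) (x : ('I_n -> nat) -> R[i]) :
  2 <= p -> (0 < k)%N -> @caratheodory R n x ->
  hsum k (fun a => cmod (x a) `^ p) <= 2 `^ p.
Proof.
move=> p2 k0 hx; have h4 := hsum_sqr_le4 hx k0.
have E c : 0 <= c -> c `^ p = c ^+ 2 * c `^ (p - 2) :> R.
  move=> c0; rewrite -powR_mulrn //.
  have [c00|cn0] := eqVneq c 0; last by rewrite -powRD ?cn0 ?implybT // addrC subrK.
  have pn0 : p != 0 by rewrite gt_eqF //; lra.
  by rewrite c00 (powR0 pn0) powR0 ?mul0r ?pnatr_eq0.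
rewrite (E 2) //; apply: (@le_trans _ _ (hsum k (fun a => cmod (x a) ^+ 2) * 2 `^ (p - 2))).
  rewrite /hsum mulr_suml; apply: ler_sum => a Pa; rewrite E ?cmod_ge0 //.
  rewrite ler_wpM2l ?sqr_ge0 //; apply: ge0_ler_powR; rewrite ?nnegrE ?cmod_ge0 ?subr_ge0 //.
  rewrite -(@ler_pXn2r _ 2) ?nnegrE ?cmod_ge0 //.
  rewrite (_ : 2 ^+ 2 = 4 :> R); last by rewrite expr2; lra.
  apply: le_trans h4; rewrite /hsum (bigD1 a) //= lerDl.
  by apply: sumr_ge0 => b _; exact: sqr_ge0.
rewrite ler_wpM2r ?powR_ge0 //; apply: (le_trans h4).
by rewrite expr2; lra.
Qed.

Lemma Hpn_lower_ge2 (R : realType) (n : nat) (p : R) : 2 <= p ->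
  ((((2 `^ p - 1) / (2 `^ (p + 1) - 1)) `^ (p^-1))%:E <= @Hpn R n p)%E.
Proof.
move=> p2; have p0 : 0 < p by lra.
rewrite powRD ?pnatr_eq0 ?implybT // powRr1 //.
have A1 : 1 < 2 `^ p :> R by exact: powR2_gt1.
set A := 2 `^ p in A1 *.
(* This [q] solves [A * q / (1 - q) = A - 1]. *)
set q := (A - 1) / _.
have q0 : 0 < q by rewrite divr_gt0; lra.
have q1 : q < 1 by rewrite ltr_pdivrMr; lra.
apply: le_ereal_inf_tmp => _ [x hx <-].
apply: Hpf_ge => //; rewrite ?powR_ge0 //; first exact: hx.1.
move=> z M zr; rewrite -/A.
apply: (@le_trans _ _ (A * \sum_(1 <= k < M) q ^+ k)); last first.
  apply: (@le_trans _ _ (A * (q / (1 - q)))).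
    by rewrite ler_wpM2l ?sum_geometric_from1_le ?(ltW q0) //; lra.
  by rewrite le_eqVlt; apply/orP; left; apply/eqP; rewrite /q; field; lra.
rewrite mulr_sumr big_nat_cond [leRHS]big_nat_cond.
apply: ler_sum => k /andP[/andP[k0 _] _].
apply: (le_trans (hsum_polydisk_le k x (ltW p0) (powR_ge0 _ _) zr)).
rewrite -powRrM mulVf ?gt_eqF // powRr1 ?(ltW q0) // mulrC.
by rewrite ler_wpM2r ?exprn_ge0 ?(ltW q0) // hsum_powR_le_ge2.
Qed.

(** * The extremal function for p >= 2 *)

Definition axis (n : nat) (j : 'I_n) (k : nat) : 'I_n -> nat :=
  fun v => if v == j then k else 0%N.

Definition on_axis (n : nat) (j : 'I_n) (a : 'I_n -> nat) : bool :=
  [forall v, (v != j) ==> (a v == 0)%N].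

Lemma hsum_axis (R : realType) (n k : nat) (j : 'I_n) (F : ('I_n -> nat) -> R) :
  (forall a, ~~ on_axis j a -> F a = 0) -> hsum k F = F (axis j k).
Proof.
move=> F0; pose a0 : {ffun 'I_n -> 'I_k.+1} := [ffun v => inord (axis j k v)].
have a0E : (fun v => val (a0 v)) = axis j k.
  apply/funext => v; rewrite ffunE /= inordK // /axis; by case: ifP.
rewrite /hsum (bigD1 a0) /=; last first.
  rewrite (bigD1 j) //= big1 => [|v vj]; last first.
    by rewrite (congr1 (@^~ v) a0E) /axis (negbTE vj).
  by rewrite (congr1 (@^~ j) a0E) /axis eqxx addn0.
rewrite a0E big1 ?addr0 // => a /andP[/eqP ak aa0]; apply: F0.
apply: contra_neqN aa0 => /forallP h; apply/ffunP => v; apply/val_inj.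
rewrite (congr1 (@^~ v) a0E) /axis; case: eqVneq => [->|vj].
  rewrite -[RHS]ak (bigD1 j) //= big1 ?addn0 // => i ij.
  by apply/eqP; exact: implyP (h i) ij.
by apply/eqP; exact: implyP (h v) vj.
Qed.

Lemma mono_axis (R : realType) (n k : nat) (j : 'I_n) (z : 'I_n -> R[i]) :
  mono z (axis j k) = z j ^+ k.
Proof.
rewrite /mono (bigD1 j) //= big1 ?mulr1 /axis ?eqxx // => v vj.
by rewrite (negbTE vj) expr0.
Qed.

(* The Taylor coefficients of [(1 + z_j) / (1 - z_j)]. *)
Definition cayley_coef (R : realType) (n : nat) (j : 'I_n) (a : 'I_n -> nat) : R[i] :=
  if on_axis j a then (if a j == 0%N then 1 else 2) else 0.

Lemma cayley_coef_axis (R : realType) (n k : nat) (j : 'I_n) :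
  cayley_coef R j (axis j k) = if k == 0%N then 1 else 2.
Proof.
rewrite /cayley_coef (_ : on_axis j _) /axis ?eqxx //.
by apply/forallP => v; apply/implyP => /negbTE ->.
Qed.

Lemma cayley_coef0 (R : realType) (n : nat) (j : 'I_n) :
  cayley_coef R j (fun=> 0%N) = 1.
Proof.
rewrite /cayley_coef (_ : on_axis j _) ?eqxx //.
by apply/forallP => v; apply/implyP.
Qed.

(** Multiplied by [|1 - z| ^ 2], the real part becomes [1 - |z| ^ 2]. *)
Lemma Re_cayley_gt0 (R : realType) (z : R[i]) :
  cmod z < 1 -> 0 < complex.Re ((1 + z) / (1 - z)).
Proof.
move=> z1; have z2 : cmod z ^+ 2 < 1 by rewrite expr_lt1 ?cmod_ge0.
have nz : 1 - z != 0.
  apply: contraTneq z1 => /eqP; rewrite subr_eq0 => /eqP <-.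
  by rewrite cmod1 ltxx.
have c0 : 0 < cmod (1 - z) ^+ 2.
  by rewrite exprn_gt0 // lt_neqAle eq_sym cmod_eq0 nz cmod_ge0.
rewrite -(pmulr_lgt0 _ c0).
have -> : complex.Re ((1 + z) / (1 - z)) * cmod (1 - z) ^+ 2 =
    complex.Re ((1 + z) * ((1 - z)^*)%C).
  have -> : (1 + z) * ((1 - z)^*)%C = (1 + z) / (1 - z) * (cmod (1 - z) ^+ 2)%:C%C.
    by rewrite -mulcJ_cmod mulrA divfK.
  by case: (_ / _) => a b /=; rewrite mulr0 subr0.
move: z2; rewrite cmod_sqr; case: z {z1 nz c0} => a b /=; rewrite !expr2; lra.
Qed.

Lemma cayley_caratheodory (R : realType) (n : nat) (j : 'I_n) :
  @caratheodory R n (cayley_coef R j).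
Proof.
split; first exact: cayley_coef0.
move=> z hz; set c := fun k : nat => (if k == 0%N then 1 else 2) : R[i].
have q1 := hz j; set q := cmod (z j) in q1.
have q0 : 0 <= q by exact: cmod_ge0.
have c2 k : cmod (c k) <= 2 by rewrite /c; case: ifP; rewrite ?cmod1 ?cmod_nat ?ler1n.
have off a : ~~ on_axis j a -> cayley_coef R j a * mono z a = 0.
  by move=> /negbTE h; rewrite /cayley_coef h mul0r.
have hE k : hsum k (fun a => cmod (cayley_coef R j a * mono z a)) =
    cmod (c k) * q ^+ k.
  rewrite (@hsum_axis _ _ _ j) => [|a /off ->]; last exact: cmod0.
  by rewrite mono_axis cayley_coef_axis cmodM cmodX.
split.
  rewrite (eq_eseriesr (fun k _ => congr1 EFin (hE k))).
  apply: (@le_lt_trans _ _ (2 / (1 - q))%:E); last exact: ltry.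
  apply: lime_le.
    by apply: is_cvg_nneseries => k _ _; rewrite lee_fin mulr_ge0 ?cmod_ge0 ?exprn_ge0.
  apply: nearW => M; rewrite sumEFin lee_fin ler_pdivlMr ?subr_gt0 //.
  rewrite big_mkord; apply: (@le_trans _ _ (2 * (\sum_(k < M) q ^+ k) * (1 - q))).
    rewrite ler_wpM2r ?subr_ge0 ?(ltW q1) // mulr_sumr; apply: ler_sum => k _.
    by rewrite ler_wpM2r ?exprn_ge0.
  rewrite -mulrA [X in _ * X]mulrC -[leRHS]mulr1 ler_wpM2l //.
  exact: sum_geometric_le.
have vE : (fun k => hsum k (fun a => complex.Re (cayley_coef R j a * mono z a))) =
    (fun k => complex.Re (c k * z j ^+ k)).
  apply/funext => k; rewrite (@hsum_axis _ _ _ j) => [|a /off ->] //.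
  by rewrite mono_axis cayley_coef_axis.
rewrite vE; set v := fun k => _.
have nz : 1 - z j != 0.
  apply: contraTneq q1 => /eqP; rewrite subr_eq0 /q => /eqP <-.
  by rewrite cmod1 ltxx.
have dn0 : 0 < cmod (1 - z j) by rewrite lt_neqAle eq_sym cmod_eq0 nz cmod_ge0.
(* Closed form of the partial sums, with a remainder that tends to 0. *)
have sumE M : \sum_(k < M.+1) c k * z j ^+ k =
    (1 + z j) / (1 - z j) - 2 * z j ^+ M.+1 / (1 - z j).
  apply: (mulIf nz); rewrite mulrBl !divfK //.
  elim: M => [|M IH]; first by rewrite big_ord1 /c /= expr0 expr1; ring.
  by rewrite big_ord_recr mulrDl IH /c /= !exprS; ring.
set l := complex.Re ((1 + z j) / (1 - z j)).
have cv : (series v @ \oo --> l)%classic.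
  rewrite -cvg_shiftS /=; apply/cvgrPdist_le => e e0.
  have nq1 : `|q| < 1 by rewrite ger0_norm.
  have [M _ hM] := (cvgr0Pnorm_le _).1 (cvg_geometric (2 / cmod (1 - z j)) nq1) _ e0.
  exists M => // m Mm; have := hM m.+1 (leqW Mm).
  rewrite /geometric /= ger0_norm; last by rewrite mulr_ge0 ?divr_ge0 ?exprn_ge0 // ltW.
  apply: le_trans.
  have -> : l - series v m.+1 = complex.Re (2 * z j ^+ m.+1 / (1 - z j)).
    rewrite /series /= big_mkord -Re_sum sumE /l.
    by case: (_ / _) => ? ?; case: (_ / _) => ? ? /=; rewrite opprB addrC subrK.
  apply: (le_trans (normRe_cmod _)); rewrite !cmodM cmodV cmodX cmod_nat.
  by rewrite mulrAC.
by rewrite (cvg_lim _ cv) // Re_cayley_gt0.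
Qed.

Lemma Hpn_upper_ge2 (R : realType) (n : nat) (p : R) : (0 < n)%N -> 2 <= p ->
  (@Hpn R n p <= (((2 `^ p - 1) / (2 `^ (p + 1) - 1)) `^ (p^-1))%:E)%E.
Proof.
move=> n0 p2; have p0 : 0 < p by lra.
rewrite powRD ?pnatr_eq0 ?implybT // powRr1 //.
have A1 : 1 < 2 `^ p :> R by exact: powR2_gt1.
set A := 2 `^ p in A1 *.
set q := (A - 1) / _.
have q0 : 0 < q by rewrite divr_gt0; lra.
have q1 : q < 1 by rewrite ltr_pdivrMr; lra.
pose j := Ordinal n0.
apply: (@le_trans _ _ (Hpf p (cayley_coef R j))).
  apply: ereal_inf_lbound; exists (cayley_coef R j) => //.
  exact: cayley_caratheodory.
apply: Hpf_le => //; first exact: cayley_coef0.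
move=> r ur r0.
have pV0 : 0 < p^-1 by rewrite invr_gt0.
have u0 : 0 <= q `^ p^-1 by exact: powR_ge0.
have u1 : q `^ p^-1 < 1.
  have := @gt0_ltr_powR R _ pV0 q 1; rewrite !nnegrE powR1 => -> //; exact: ltW.
(* The test radius also stays below 1, so that the geometric tail tends to 0. *)
have [r' [r'r r'1 ur']] : exists r', [/\ r' < r, r' < 1 & q `^ p^-1 < r'].
  have h : q `^ p^-1 < Num.min r 1 by rewrite lt_min ur.
  exists ((q `^ p^-1 + Num.min r 1) / 2).
  have h1 : Num.min r 1 <= r by rewrite ge_min lexx.
  have h2 : Num.min r 1 <= 1 by rewrite ge_min lexx orbT.
  move: (q `^ p^-1) (Num.min r 1) h h1 h2 => u w h h1 h2.
  by split; lra.
have r'0 : 0 <= r' by apply: le_trans (ltW ur').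
exists (fun=> r'%:C%C); first by move=> v; rewrite cmod_real ger0_norm.
pose t := r' `^ p.
have tq : q < t.
  have := @gt0_ltr_powR R _ p0 (q `^ p^-1) r'; rewrite !nnegrE -powRrM mulVf ?gt_eqF //.
  by rewrite powRr1 ?(ltW q0) //; apply.
have t1 : t < 1.
  by have := @gt0_ltr_powR R _ p0 r' 1; rewrite !nnegrE powR1; apply.
have t0 : 0 <= t by exact: powR_ge0.
(* This is [A t - (A - 1) (1 - t)], positive because [t > q]. Once [A t ^ M] is at most this gap,
   the sum of [A t ^ k] over [1 <= k <= M] exceeds [A - 1]. *)
have e0 : 0 < (2 * A - 1) * t - (A - 1).
  have A2 : 0 < A * 2 - 1 by lra.
  have : q * (A * 2 - 1) < t * (A * 2 - 1) by rewrite ltr_pM2r.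
  by rewrite /q divfK ?gt_eqF //; lra.
have nt1 : `|t| < 1 by rewrite ger0_norm.
have [M _ hM] := (cvgr0Pnorm_le _).1 (cvg_geometric A nt1) _ e0.
exists M.+1; have := hM M (leqnn M).
rewrite /geometric /= ger0_norm; last by rewrite mulr_ge0 ?exprn_ge0 ?(ltW A0) //; lra.
move=> hA.
have hE k : hsum k.+1 (fun a => cmod (cayley_coef R j a *
    mono (fun=> r'%:C%C) a) `^ p) = A * t ^+ k.+1.
  rewrite (@hsum_axis _ _ _ j) => [|a /negbTE h]; last first.
    by rewrite /cayley_coef h mul0r cmod0 powR0 // gt_eqF.
  rewrite mono_axis cayley_coef_axis cmodM cmodX cmod_nat cmod_real ger0_norm //.
  by rewrite powRM ?exprn_ge0 // powR_exprn.
rewrite big_add1 /= big_mkord.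
rewrite (eq_bigr (fun k : 'I_M => A * t ^+ k.+1)) => [|k _]; last exact: hE.
rewrite -mulr_sumr.
under eq_bigr do rewrite exprS.
rewrite -mulr_sumr.
have : (1 - t) * \sum_(k < M) t ^+ k = 1 - t ^+ M.
  by rewrite -opprB mulNr -subrX1 opprB.
move: (\sum_(k < M) t ^+ k) (t ^+ M) hA e0 => S T hA e0 hS.
rewrite -(ltr_pM2l (_ : 0 < 1 - t)) ?subr_gt0 //.
have -> : (1 - t) * (A * (t * S)) = A * t * ((1 - t) * S) by ring.
have t1' : 0 < 1 - t by rewrite subr_gt0.
rewrite hS; have := ler_wpM2l t0 hA; have := mulr_gt0 t1' e0.
rewrite -/A; lra.
Qed.

(** * Upper bounds for p < 2 *)

(** Bridges two indexings: [hsum] runs over all multi-indices of a degree, the test polynomials over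
    words. *)
Lemma sum_homog_family (V : nmodType) (n m : nat) (I : finType)
    (e : I -> 'I_n -> nat) (G : ('I_n -> nat) -> V) :
  (forall i i', e i =1 e i' -> i = i') -> (forall i, \sum_v e i v = m)%N ->
  (forall a, (forall i, e i <> a) -> G a = 0) ->
  \sum_(a : {ffun 'I_n -> 'I_m.+1} | (\sum_(i < n) val (a i))%N == m)
    G (fun v => val (a v)) = \sum_i G (e i).
Proof.
move=> einj em G0.
pose f i : {ffun 'I_n -> 'I_m.+1} := [ffun v => inord (e i v)].
have fE i v : f i v = e i v :> nat.
  by rewrite ffunE inordK // ltnS -(em i) (bigD1 v) //= leq_addr.
have finj : injective f.
  by move=> i i' h; apply: einj => v; rewrite -!fE h.
rewrite (bigID (mem (f @: [set: I]))) /= [X in _ + X]big1 ?addr0; last first.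
  move=> a /andP[_ ha]; apply: G0 => i ia; move/negP: ha; apply.
  apply/imsetP; exists i => //; apply/ffunP => v; apply/val_inj.
  by rewrite /= fE ia.
rewrite (eq_bigl (mem (f @: [set: I]))) => [|a]; last first.
  rewrite /= andb_idl // => /imsetP[i _ ->].
  by rewrite -[X in _ == X](em i); apply/eqP/eq_bigr => v _; exact: fE.
rewrite big_imset /=; last by move=> i i' _ _; exact: finj.
apply: eq_big => [i|i _]; first by rewrite inE.
by congr G; apply/funext => v; exact: fE.
Qed.

(* The coefficients of [1 + \sum_i c i * z ^ e i]. *)
Definition poly_coef (R : realType) (n : nat) (I : finType)
    (e : I -> 'I_n -> nat) (c : I -> R[i]) (a : 'I_n -> nat) : R[i] :=
  if [forall v, a v == 0%N] then 1
  else \sum_(i | [forall v, e i v == a v]) c i.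

Lemma poly_coef0 (R : realType) (n : nat) (I : finType)
    (e : I -> 'I_n -> nat) (c : I -> R[i]) : poly_coef e c (fun=> 0%N) = 1.
Proof. by rewrite /poly_coef (_ : [forall _, _]) //; apply/forallP. Qed.

(** [G] is abstract because the same reindexing serves the polynomial itself and its sum of [p]-th
    powers. *)
Lemma sum_poly_coef (R : realType) (V : nmodType) (n m : nat) (I : finType)
    (e : I -> 'I_n -> nat) (c : I -> R[i]) (G : R[i] -> ('I_n -> nat) -> V) :
  (0 < m)%N -> (forall i i', e i =1 e i' -> i = i') ->
  (forall i, \sum_v e i v = m)%N -> (forall a, G 0 a = 0) ->
  \sum_(a : {ffun 'I_n -> 'I_m.+1} | (\sum_(i < n) val (a i))%N == m)
    G (poly_coef e c (fun v => val (a v))) (fun v => val (a v)) =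
  \sum_i G (c i) (e i).
Proof.
move=> m0 einj em G0.
have nz i : [forall v, e i v == 0%N] = false.
  apply/negbTE; apply: contraL m0 => /forallP h.
  by rewrite -(em i) big1 // => v _; apply/eqP.
(* Without the constant term, the coefficients vanish off the family. *)
pose x a := if [forall v, a v == 0%N] then 0 else poly_coef e c a.
rewrite (eq_bigr (fun a : {ffun 'I_n -> 'I_m.+1} =>
    G (x (fun v => val (a v))) (fun v => val (a v)))); last first.
  move=> a /eqP am; rewrite /x; case: forallP => // h.
  by move: m0; rewrite -[X in (_ < X)%N]am big1 // => v _; apply/eqP.
rewrite (sum_homog_family (G := fun a => G (x a) a) einj em).
  apply: eq_bigr => i _; rewrite /x /poly_coef nz (big_pred1 i) // => i'.
  by apply/forallP/eqP => [h|-> v //]; apply: einj => v; apply/eqP.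
move=> a ha; rewrite /x /poly_coef; case: ifP => [_|h0]; first exact: G0.
rewrite h0 big_pred0 ?G0 // => i.
apply/negbTE/negP => /forallP h; apply: (ha i); apply/funext => v.
exact/eqP.
Qed.

Lemma poly_coef_deg (R : realType) (n m k : nat) (I : finType)
    (e : I -> 'I_n -> nat) (c : I -> R[i]) (a : {ffun 'I_n -> 'I_k.+1}) :
  (forall i, \sum_v e i v = m)%N -> (\sum_(i < n) val (a i))%N == k ->
  (0 < k)%N -> k != m -> poly_coef e c (fun v => val (a v)) = 0.
Proof.
move=> em /eqP ak k0 km; rewrite /poly_coef.
case: forallP => [h|_].
  by move: k0; rewrite -[X in (_ < X)%N]ak big1 // => v _; apply/eqP.
rewrite big_pred0 // => i; apply/negbTE; apply: contra_neqN km => /forallP h.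
by rewrite -(em i) -[LHS]ak; apply: eq_bigr => v _; apply/esym/eqP.
Qed.

(** From [|P| < 1] follows [Re (1 + P) > 0], and all partial sums are eventually constant. *)
Lemma poly_caratheodory (R : realType) (n m : nat) (I : finType)
    (e : I -> 'I_n -> nat) (c : I -> R[i]) :
  (0 < m)%N -> (forall i i', e i =1 e i' -> i = i') ->
  (forall i, \sum_v e i v = m)%N ->
  (forall z, @polydisk R n 1 z -> cmod (\sum_i c i * mono z (e i)) < 1) ->
  @caratheodory R n (poly_coef e c).
Proof.
move=> m0 einj em hP; split; first exact: poly_coef0.
move=> z hz; set x := poly_coef e c.
have x0 k (F : R[i] -> R) : F 0 = 0 -> (0 < k)%N -> k != m ->
    hsum k (fun a => F (x a * mono z a)) = 0.
  move=> F0 k0 km; rewrite /hsum big1 // => a ak.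
  by rewrite /x (poly_coef_deg c em ak) // mul0r.
have stab (u : R^nat) : (forall k, (0 < k)%N -> k != m -> u k = 0) ->
    forall M, (m < M)%N -> series u M = series u m.+1.
  move=> u0 M mM; rewrite /series /= (big_cat_nat (n := m.+1)) //=.
  rewrite [X in _ + X]big_nat_cond [X in _ + X]big1 ?addr0 // => k /andP[/andP[mk _] _].
  by rewrite u0 ?gtn_eqF //; apply: leq_ltn_trans mk.
split.
  set u := fun k => hsum k (fun a => cmod (x a * mono z a)).
  have hu := stab u (fun k => x0 k _ (cmod0 R)).
  apply: (@le_lt_trans _ _ (series u m.+1)%:E); last exact: ltry.
  apply: lime_le.
    apply: is_cvg_nneseries => k _ _; rewrite lee_fin hsum_ge0 // => a; exact: cmod_ge0.
  by exists m.+1 => // M /= mM; rewrite sumEFin lee_fin -(hu M mM).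
set v := fun k => hsum k (fun a => complex.Re (x a * mono z a)).
have hv := stab v (fun k => x0 k _ erefl).
have cv : (series v @ \oo --> series v m.+1)%classic.
  by apply: cvg_near_cst; exists m.+1 => // M /= mM; exact: hv.
rewrite (cvg_lim _ cv) // /series /= big_nat_recr //= big_ltn //.
rewrite [X in _ + X + _]big_nat_cond [X in _ + X + _]big1 => [|k]; last first.
  by move=> /andP[/andP[k0 km] _]; rewrite /v x0 ?ltn_eqF.
rewrite addr0 /v !Re_hpoly hpoly0 /x poly_coef0 /=.
rewrite /hpoly (sum_poly_coef c (G := fun w a => w * mono z a)) // => [|a]; last first.
  exact: mul0r.
have := normRe_cmod (\sum_i c i * mono z (e i)); have := hP z hz.
move: (\sum_i _) => P h1; rewrite ler_norml => /andP[h2 _]; lra.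
Qed.

(** Test at a point with all coordinates equal to a radius above [u]: the terms of degree [m] add up
    to at least [2 ^ p], beyond the threshold [2 ^ p - 1]. *)
Lemma Hpn_poly_le (R : realType) (n m : nat) (p u A : R) (I : finType)
    (e : I -> 'I_n -> nat) (c : I -> R[i]) :
  (0 < m)%N -> (forall i i', e i =1 e i' -> i = i') ->
  (forall i, \sum_v e i v = m)%N ->
  (forall z, @polydisk R n 1 z -> cmod (\sum_i c i * mono z (e i)) < 1) ->
  0 < p -> 0 <= u -> 0 <= A -> (forall i, cmod (c i) = A) ->
  2 `^ p <= #|I|%:R * A `^ p * (u `^ p) ^+ m ->
  (@Hpn R n p <= u%:E)%E.
Proof.
move=> m0 einj em hP p0 u0 A0 cA hu.
apply: (@le_trans _ _ (Hpf p (poly_coef e c))).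
  apply: ereal_inf_lbound; exists (poly_coef e c) => //.
  exact: (poly_caratheodory m0 einj em hP).
apply: Hpf_le => //; first exact: poly_coef0.
move=> r ur r0; have ur2 : u < (u + r) / 2 by lra.
have r2 : (u + r) / 2 < r by lra.
set r' := (u + r) / 2 in ur2 r2; have r'0 : 0 <= r' by apply: le_trans (ltW ur2).
exists (fun=> r'%:C%C); first by move=> v; rewrite cmod_real ger0_norm.
exists m.+1; rewrite big_nat_recr //=.
set S := \sum_(1 <= k < m) _.
have S0 : 0 <= S.
  by apply: sumr_ge0 => k _; apply: hsum_ge0 => a; exact: powR_ge0.
rewrite [X in S + X](_ : _ = #|I|%:R * A `^ p * (r' `^ p) ^+ m).
  have h : #|I|%:R * A `^ p * (u `^ p) ^+ m <= #|I|%:R * A `^ p * (r' `^ p) ^+ m.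
    rewrite ler_wpM2l ?mulr_ge0 ?powR_ge0 //; apply: lerXn2r; rewrite ?nnegrE ?powR_ge0 //.
    by apply: ge0_ler_powR; rewrite ?nnegrE ?(ltW p0) // ltW.
  lra.
rewrite /hsum (sum_poly_coef c (G := fun w a => cmod (w * mono (fun=> r'%:C%C) a) `^ p)) //.
  rewrite (eq_bigr (fun=> A `^ p * (r' `^ p) ^+ m)).
    by rewrite sumr_const -[RHS]mulrA [RHS]mulr_natl.
  move=> i _; rewrite cmodM cA powRM ?cmod_ge0 // /mono prodrXr em cmodX cmod_real.
  by rewrite ger0_norm // powR_exprn.
by move=> a; rewrite mul0r cmod0 powR0 // gt_eqF.
Qed.

(** * Word polynomials and iterated Fourier matrices *)

(* Words with [m.+1] letters in ['I_N]. *)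
Fixpoint word (N m : nat) : finType :=
  if m is m'.+1 then (word N m' * 'I_N)%type else 'I_N.

Definition last_letter (N m : nat) : word N m -> 'I_N :=
  if m is m'.+1 then snd else id.

(* Letter [i] at position [m] stands for the variable of index [m * N + i]. *)
Fixpoint word_exp (N m : nat) : word N m -> nat -> nat :=
  if m is m'.+1 then
    fun u v => (word_exp u.1 v + (v == m'.+1 * N + u.2))%N
  else fun i v => (v == i :> nat) : nat.

(** A product of Fourier matrix entries along consecutive letters, so that a sum over words is an
    iterated matrix product. *)
Fixpoint word_coef (R : realType) (w : R[i]) (N m : nat) : word N m -> R[i] :=
  if m is m'.+1 then
    fun u => word_coef w u.1 * w ^+ (last_letter u.1 * u.2)
  else fun=> 1.

Lemma card_word (N m : nat) : #|word N m| = (N ^ m.+1)%N.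
Proof.
elim: m => [|m IH] /=; first by rewrite card_ord expn1.
by rewrite card_prod IH card_ord -expnSr.
Qed.

Lemma word_exp_big (N m v : nat) (u : word N m) :
  (m.+1 * N <= v)%N -> word_exp u v = 0%N.
Proof.
elim: m u => [|m IH] /= u hv.
  by rewrite gtn_eqF // (leq_trans (ltn_ord u)) // -[X in (X <= _)%N]mul1n.
rewrite IH; last by apply: leq_trans hv; rewrite leq_mul2r leqnSn orbT.
by rewrite gtn_eqF // (leq_trans _ hv) // [leqRHS]mulSn addnC ltn_add2r.
Qed.

(** Positions own disjoint blocks of [N] variables: the last block determines the last letter, the
    earlier blocks the rest. *)
Lemma word_exp_inj (N m : nat) (u u' : word N m) :
  (forall v, (v < m.+1 * N)%N -> word_exp u v = word_exp u' v) -> u = u'.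
Proof.
elim: m u u' => [|m IH] /= u u' h.
  have := h u; rewrite mul1n ltn_ord eqxx => /(_ isT).
  by case: eqVneq => // /val_inj.
case: u u' h => [u i] [u' i'] /= h.
have uu' : u = u'.
  apply: IH => v hv; have := h v; rewrite !ltn_eqF ?addn0; first last.
  - by apply: leq_trans hv (leq_addr _ _).
  - by apply: leq_trans hv (leq_addr _ _).
  by apply; apply: leq_trans hv _; rewrite leq_mul2r leqnSn orbT.
have := h (m.+1 * N + i)%N; rewrite !word_exp_big ?leq_addr // eqxx.
rewrite eqn_add2l [X in (_ < X)%N]mulSn addnC ltn_add2r ltn_ord => /(_ isT).
by case: eqVneq => // /val_inj ->; rewrite uu'.
Qed.

Lemma sum_word_exp (N m n : nat) (u : word N m) :
  (m.+1 * N <= n)%N -> (\sum_(v < n) word_exp u v = m.+1)%N.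
Proof.
have one c : (c < n)%N -> (\sum_(v < n) (v == c :> nat) = 1)%N.
  move=> cn; rewrite (bigD1 (Ordinal cn)) //= eqxx big1 // => v hv.
  by rewrite (_ : (v == c :> nat) = false) //; exact: negbTE hv.
elim: m u => [|m IH] /= u hn.
  by rewrite one // (leq_trans (ltn_ord u)) // -[X in (X <= _)%N]mul1n.
rewrite big_split /= IH; last by apply: leq_trans hn; rewrite leq_mul2r leqnSn orbT.
rewrite one ?addn1 // (leq_trans _ hn) // [leqRHS]mulSn addnC ltn_add2r.
exact: ltn_ord.
Qed.

(** Indexed by natural numbers to match [word_exp]; the default 0 out of range respects the bound by
    1. *)
Definition coord (R : realType) (n : nat) (z : 'I_n -> R[i]) (c : nat) : R[i] :=
  oapp z 0 (insub c).

Lemma mono_coord (R : realType) (n c : nat) (z : 'I_n -> R[i]) : (c < n)%N ->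
  mono z (fun v => (v == c :> nat) : nat) = coord z c.
Proof.
move=> cn; rewrite /coord insubT /= /mono (bigD1 (Ordinal cn)) //= eqxx expr1.
rewrite big1 ?mulr1 // => v hv.
by rewrite (_ : (v == c :> nat) = false) ?expr0 //; exact: negbTE hv.
Qed.

Lemma cmod_coord (R : realType) (n c : nat) (z : 'I_n -> R[i]) :
  @polydisk R n 1 z -> cmod (coord z c) <= 1.
Proof.
move=> hz; rewrite /coord; case: insubP => [v _ _|_]; last by rewrite cmod0.
exact: ltW (hz v).
Qed.

(** As [i] varies, this is the vector on which the next Fourier matrix acts. *)
Definition word_sum (R : realType) (w : R[i]) (N m n : nat) (z : 'I_n -> R[i])
    (i : 'I_N) : R[i] :=
  \sum_(u : word N m | last_letter u == i)
    word_coef w u * mono z (fun v => word_exp u v).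

Lemma sum_word_sum (R : realType) (w : R[i]) (N m n : nat) (z : 'I_n -> R[i])
    (f : 'I_N -> R[i]) :
  \sum_i word_sum w m z i * f i =
  \sum_(u : word N m) word_coef w u * mono z (fun v => word_exp u v) *
    f (last_letter u).
Proof.
rewrite [RHS](partition_big (@last_letter N m) predT) //=.
apply: eq_bigr => i _; rewrite /word_sum mulr_suml.
by apply: eq_bigr => u /eqP ->.
Qed.

(* Appending a letter applies the discrete Fourier matrix, of norm [sqrt N],
   followed by a diagonal contraction. *)
Lemma word_sum_sqr_le (R : realType) (w : R[i]) (N m n : nat) (z : 'I_n -> R[i]) :
  (0 < N)%N -> N.-primitive_root w -> (m.+1 * N <= n)%N -> @polydisk R n 1 z ->
  \sum_(i < N) cmod (word_sum w m z i) ^+ 2 <= N%:R ^+ m.+1.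
Proof.
move=> N0 pw + hz; elim: m => [|m IH] mN.
  apply: (@le_trans _ _ (\sum_(i < N) 1)).
    apply: ler_sum => i _; rewrite /word_sum (big_pred1 i) //= mul1r.
    rewrite mono_coord; first by rewrite exprn_ile1 ?cmod_ge0 ?cmod_coord.
    by rewrite (leq_trans (ltn_ord i)) // -[X in (X <= _)%N]mul1n.
  by rewrite sumr_const card_ord expr1.
have mN' : (m.+1 * N <= n)%N by apply: leq_trans mN; rewrite leq_mul2r leqnSn orbT.
have E (i : 'I_N) : word_sum w m.+1 z i = coord z (m.+1 * N + i) *
    \sum_(j < N) word_sum w m z j * w ^+ (j * i).
  rewrite (sum_word_sum w m z (fun j => w ^+ (j * i))) mulr_sumr /word_sum /=.
  rewrite (eq_bigl (fun u : word N m * 'I_N => true && (u.2 == i))) //.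
  rewrite -(pair_big predT (fun j : 'I_N => j == i)
    (fun (u : word N m) j => word_coef w u * w ^+ (last_letter u * j) *
      mono z (fun v : 'I_n => (word_exp u v + (v == m.+1 * N + j :> nat))%N))) /=.
  apply: eq_bigr => u _; rewrite big_pred1_eq mono_add mono_coord.
    by ring.
  by rewrite (leq_trans _ mN) // [leqRHS]mulSn addnC ltn_add2r.
apply: (@le_trans _ _ (\sum_(i < N) cmod (\sum_(j < N) word_sum w m z j * w ^+ (j * i)) ^+ 2)).
  apply: ler_sum => i _; rewrite E cmodM exprMn ler_piMl ?sqr_ge0 //.
  by rewrite exprn_ile1 ?cmod_ge0 ?cmod_coord.
rewrite (parseval (A := N%:R) (chi := fun (j i : 'I_N) => w ^+ (j * i))).
  by rewrite exprS ler_wpM2l // IH.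
move=> i j _ _; rewrite rmorph_nat -(sum_prim_root N0 pw (ltn_ord i) (ltn_ord j)).
by apply: eq_bigr => s _; rewrite !(mulnC s).
Qed.

(** Cauchy-Schwarz over the [N] possible last letters costs one more factor [N]. *)
Lemma cmod_word_poly_le (R : realType) (w : R[i]) (N m n : nat) (z : 'I_n -> R[i]) :
  (0 < N)%N -> N.-primitive_root w -> (m.+1 * N <= n)%N -> @polydisk R n 1 z ->
  cmod (\sum_(u : word N m) word_coef w u * mono z (fun v => word_exp u v)) ^+ 2
    <= N%:R ^+ m.+2.
Proof.
move=> N0 pw mN hz.
have -> : \sum_(u : word N m) word_coef w u * mono z (fun v => word_exp u v) =
    \sum_(i < N) word_sum w m z i.
  by rewrite (partition_big (@last_letter N m) predT).
apply: (@le_trans _ _ ((\sum_(i < N) cmod (word_sum w m z i)) ^+ 2)).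
  apply: lerXn2r; rewrite ?nnegrE ?cmod_ge0 ?cmod_sum // sumr_ge0 // => i _.
  exact: cmod_ge0.
apply: (le_trans (sqr_sum_le _ _)).
by rewrite cardT size_enum_ord exprS ler_wpM2l // word_sum_sqr_le.
Qed.

Lemma cmod_word_coef (R : realType) (w : R[i]) (N m : nat) (u : word N m) :
  cmod w = 1 -> cmod (word_coef w u) = 1.
Proof.
move=> w1; elim: m u => [|m IH] /= u; first exact: cmod1.
by rewrite cmodM IH cmodX w1 expr1n mulr1.
Qed.

(** Divided by [2 N ^ ((m + 2) / 2)], the word polynomial is at most 1/2 in modulus. The last
    hypothesis is the criterion of [Hpn_poly_le] with denominators cleared: in [4 ^ p], one [2 ^ p]
    is the threshold and the other comes from this normalization. *)
Lemma Hpn_word_le (R : realType) (n m N : nat) (p u : R) :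
  (0 < N)%N -> (m.+1 * N <= n)%N -> 0 < p -> 0 <= u ->
  4 `^ p * (N%:R ^+ m.+2) `^ (p / 2) <= N%:R ^+ m.+1 * (u `^ p) ^+ m.+1 ->
  (@Hpn R n p <= u%:E)%E.
Proof.
move=> N0 mN p0 u0 hu.
have [w pw] := prim_root_exists R N0.
have w1 := cmod_prim_root N0 pw.
have Np : (0 : R) < N%:R by rewrite ltr0n.
pose B : R := Num.sqrt (N%:R ^+ m.+2).
have B0 : 0 < B by rewrite sqrtr_gt0 exprn_gt0.
have B2 : B ^+ 2 = N%:R ^+ m.+2 by rewrite sqr_sqrtr // exprn_ge0.
have cB : 0 < (2 * B)^-1 by rewrite invr_gt0 mulr_gt0.
apply: (@Hpn_poly_le R n m.+1 p u (2 * B)^-1 (word N m)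
  (fun x v => word_exp x v) (fun x => ((2 * B)^-1)%:C%C * word_coef w x)) => //.
- move=> x x' h; apply: word_exp_inj => v hv.
  exact: h (Ordinal (leq_trans hv mN)).
- by move=> x; exact: sum_word_exp.
- move=> z hz; have := cmod_word_poly_le N0 pw mN hz.
  under [in X in _ -> X]eq_bigr do rewrite -mulrA.
  rewrite -mulr_sumr cmodM cmod_real gtr0_norm // -B2.
  rewrite ler_pXn2r ?nnegrE ?cmod_ge0 ?(ltW B0) // => h.
  rewrite ltr_pdivrMl ?mulr_gt0 // mulr1; lra.
- exact: ltW.
- by move=> x; rewrite cmodM cmod_word_coef // cmod_real gtr0_norm // mulr1.
rewrite card_word natrX.
have -> : (2 * B)^-1 `^ p = (2 `^ p * (N%:R ^+ m.+2) `^ (p / 2))^-1.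
  rewrite -B2 (sqr_powR_half _ (ltW B0)) -powRM ?(ltW B0) //.
  by rewrite -(powR_inv1 (mulr_ge0 _ (ltW B0))) // -powRrM mulN1r powRN.
rewrite mulrAC ler_pdivlMr ?mulr_gt0 ?powR_gt0 ?exprn_gt0 //.
by rewrite mulrA -powRM // (_ : 2 * 2 = 4 :> R) //; lra.
Qed.

Lemma ln2_ge (R : realType) : 2^-1 <= ln 2 :> R.
Proof.
have h : -1 < - 2^-1 :> R by lra.
have := le_ln1Dx h; rewrite (_ : 1 - 2^-1 = 2^-1 :> R); last by lra.
by rewrite lnV ?posrE // lerN2.
Qed.

Lemma Hpn_upper_lt2 (R : realType) (p : R) : 0 < p < 2 ->
  exists2 D : R, 0 < D & forall n : nat, (1 < n)%N ->
    (@Hpn R n p <= (D * (ln (n%:R) / n%:R) `^ ((2 - p) / (2 * p)))%:E)%E.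
Proof.
move=> /andP[p0 p2]; pose s := 1 - p / 2.
have s0 : 0 < s by rewrite /s; lra.
have s1 : s < 1 by rewrite /s; lra.
(* Of the four factors 4, one pays for [N >= n / (4 ln n)], two for [4 ^ p <= 16] and one for
   [N ^ (p / 2) <= 4 ^ (m + 1)]. *)
exists ((4 ^+ 4) `^ p^-1); first by rewrite powR_gt0 // exprn_gt0.
move=> n n1; have L0 := @ln_nat_gt0 R n n1.
have np : (0 : R) < n%:R by rewrite ltr0n ltnW.
set L := ln n%:R in L0 *.
(* With about [log_2 n] letters, the surplus factor [N ^ (p / 2)] from the sup norm costs only a
   constant per degree. *)
have [m mE] : exists m, trunc_log 2 n = m.+1.
  by exists (trunc_log 2 n).-1; rewrite prednK // trunc_log_gt0.
have lo : (2 ^ m.+1 <= n)%N by rewrite -mE trunc_logP // ltnW.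
have hi : (n < 2 ^ m.+2)%N by rewrite -mE trunc_log_ltn.
pose N := (n %/ m.+1)%N.
have mn : (m.+1 <= n)%N by apply: leq_trans lo; exact/ltnW/ltn_expl.
have N0 : (0 < N)%N by rewrite divn_gt0.
have Np : (0 : R) < N%:R by rewrite ltr0n.
have mN : (m.+1 * N <= n)%N by rewrite mulnC leq_trunc_div.
have mL : (m.+1%:R : R) <= 2 * L.
  have : m.+1%:R * ln 2 <= L :> R.
    rewrite mulr_natl -lnXn // ler_ln ?posrE ?exprn_gt0 //.
    by rewrite -natrX ler_nat.
  have := ler_wpM2l (ler0n R m.+1) (ln2_ge R); lra.
have nNL : n%:R / L / 4 <= N%:R :> R.
  rewrite ler_pdivrMr // ler_pdivrMr //.
  have h : (n <= 2 * (m.+1 * N))%N.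
    apply: (@leq_trans (N.+1 * m.+1)); first by rewrite ltnW // ltn_ceil.
    by rewrite mulnC mul2n -addnn mulnS addnC leq_add2l -[X in (X <= _)%N]muln1 leq_mul2l N0 orbT.
  have : (n%:R : R) <= 2 * (m.+1%:R * N%:R) by rewrite -!natrM ler_nat.
  have := ler_wpM2r (ltW Np) mL; lra.
set u := _ * _; have u0 : 0 <= u by rewrite mulr_ge0 ?powR_ge0.
apply: (Hpn_word_le N0 mN p0 u0).
have uE : u `^ p = 4 ^+ 4 * (L / n%:R) `^ s.
  rewrite /u powRM ?powR_ge0 // -!powRrM mulVf ?gt_eqF // powRr1 ?exprn_ge0 //.
  by congr (_ * _ `^ _); rewrite /s; field; rewrite gt_eqF.
have uN : 4 ^+ 3 <= u `^ p * N%:R `^ s.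
  have h : (n%:R / L) `^ s / 4 <= N%:R `^ s.
    apply: (@le_trans _ _ ((n%:R / L / 4) `^ s)).
      rewrite [leRHS]powRM ?divr_ge0 ?(ltW np) ?(ltW L0) //.
      rewrite ler_wpM2l ?powR_ge0 // -(powR_inv1 (_ : 0 <= 4)) // -powRrM mulN1r.
      by apply: ler_powR; [rewrite ler1n | rewrite lerN2 ltW].
    apply: ge0_ler_powR; rewrite ?nnegrE ?(ltW s0) //.
    by rewrite !divr_ge0 ?(ltW np) ?(ltW L0).
  have e1 : (L / n%:R) `^ s * (n%:R / L) `^ s = 1.
    rewrite -powRM ?divr_ge0 ?(ltW np) ?(ltW L0) //.
    by rewrite (_ : _ * _ = 1) ?powR1 //; field; rewrite !gt_eqF.
  rewrite uE; apply: (@le_trans _ _ (4 ^+ 4 * (L / n%:R) `^ s * ((n%:R / L) `^ s / 4))).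
    have -> : 4 ^+ 4 * (L / n%:R) `^ s * ((n%:R / L) `^ s / 4) =
        4 ^+ 3 * ((L / n%:R) `^ s * (n%:R / L) `^ s).
      by rewrite exprSr; field.
    by rewrite e1 mulr1.
  by apply: ler_wpM2l h; rewrite mulr_ge0 ?powR_ge0 ?exprn_ge0.
have NE : (N%:R : R) = N%:R `^ s * N%:R `^ (p / 2).
  rewrite -powRD; last by rewrite (gt_eqF Np) implybT.
  by rewrite /s subrK powRr1 // ltW.
rewrite -exprMn powR_exprn ?(ltW Np) //.
have -> : N%:R * u `^ p = u `^ p * N%:R `^ s * N%:R `^ (p / 2).
  by rewrite {1}NE; ring.
rewrite [leRHS]exprMn exprS mulrA ler_wpM2r ?exprn_ge0 ?powR_ge0 //.
apply: (@le_trans _ _ ((4 ^+ 3) ^+ m.+1)); last first.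
  by apply: lerXn2r uN; rewrite ?nnegrE ?exprn_ge0 ?mulr_ge0 ?powR_ge0.
rewrite (exprSr (4 : R) 2) exprMn.
apply: ler_pM; rewrite ?powR_ge0 //.
  apply: (@le_trans _ _ (4 `^ 2%:R)).
    by apply: ler_powR; [rewrite ler1n | exact: ltW].
  by rewrite powR_mulrn // ler_eXnr // exprn_ege1 // ler1n.
apply: (@le_trans _ _ N%:R).
  by apply: ler1_powR; [rewrite ler1n | lra].
rewrite -natrX ler_nat; apply: leq_trans (leq_div _ _) _.
apply: leq_trans (ltnW hi) _.
have -> : (4 ^ m.+1 = 2 ^ (2 * m.+1))%N by rewrite expnM.
by rewrite leq_exp2l // mul2n -addnn addnS ltnS leq_addr.
Qed.

Theorem theorem1p5 (R : realType) :
  (forall (n : nat) (p : R), (1 < n)%N -> 2 <= p ->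
     @Hpn R n p = (((2 `^ p - 1) / (2 `^ (p + 1) - 1)) `^ (p^-1))%:E) /\
  (forall p : R, 0 < p < 2 ->
     exists C D : R, 0 < C /\ 0 < D /\
       forall n : nat, (1 < n)%N ->
         ((C * (ln (n%:R) / n%:R) `^ ((2 - p) / (2 * p)))%:E <= @Hpn R n p)%E /\
         (@Hpn R n p <= (D * (ln (n%:R) / n%:R) `^ ((2 - p) / (2 * p)))%:E)%E).
Proof.
split=> [n p n1 p2|p p02].
  apply/eqP; rewrite eq_le Hpn_lower_ge2 // andbT.
  exact: Hpn_upper_ge2 (ltnW n1) p2.
have [C C0 hC] := Hpn_lower_lt2 p02; have [D D0 hD] := Hpn_upper_lt2 p02.
by exists C, D; do 2!split=> //; move=> n n1; split; [exact: hC | exact: hD].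
Qed.
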